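(* Let $\Omega\subset\mathbb{H}$ be an axially symmetric domain and let $\lambda\in\mathbb{H}$. A function $f\in\mathcal{S}^1(\Omega)$ satisfies $\frac{\partial f}{\partial x}=f\lambda$ on $\Omega$ if and only if $f=g\cdot\exp_\lambda(x)$ with $g\in\overline{\mathcal{SR}}(\Omega)$ anti-slice-regular. Such a solution $f$ is slice-regular on $\Omega$ if and only if $g\in\overline{\mathcal{SR}}(\Omega)\cap\mathcal{SR}(\Omega)=\mathcal{SC}(\Omega)$, i.e., $g$ is slice-constant on $\Omega$ (constant if $\Omega$ is a slice domain).
   Context: $\mathbb{H}$ is the skew field of quaternions, $\mathbb{S}=\{J\in\mathbb{H}: J^2=-1\}$, $\mathbb{C}_J=\mathbb{R}+J\mathbb{R}$. For an open set $D\subseteq\mathbb{C}$ invariant under complex conjugation, put $\Omega_D=\{\alpha+J\beta:\ \alpha+i\beta\in D,\ J\in\mathbb{S}\}\subseteq\mathbb{H}$. An axially symmetric domain is a connected open set $\Omega=\Omega_D$ of this form; it is a slice domain if $\Omega\cap\mathbb{R}\neq\emptyset$ and a product domain if $\Omega\cap\mathbb{R}=\emptyset$. A stem function on $D$ is a map $F=F_1+\imath F_2:D\to\mathbb{H}\otimes_{\mathbb{R}}\mathbb{C}$ ($F_1,F_2$ $\mathbb{H}$-valued, $\imath$ the central imaginary unit of the factor $\mathbb{C}$) with $F(\overline z)=\overline{F(z)}$, conjugation acting on the factor $\mathbb{C}$. It induces the slice function $f=\mathcal{I}(F):\Omega_D\to\mathbb{H}$, $f(\alpha+J\beta)=F_1(\alpha+i\beta)+JF_2(\alpha+i\beta)$.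 $\mathcal{S}^1(\Omega)$ is the set of slice functions induced by stem functions of class $C^1$. Slice derivatives: $\frac{\partial f}{\partial x}=\mathcal{I}(\frac{\partial F}{\partial z})$, $\frac{\partial f}{\partial x^c}=\mathcal{I}(\frac{\partial F}{\partial\overline z})$, where $\frac{\partial}{\partial z}=\frac12(\partial_\alpha-\imath\partial_\beta)$, $\frac{\partial}{\partial\overline z}=\frac12(\partial_\alpha+\imath\partial_\beta)$. $f$ is slice-regular if $\frac{\partial f}{\partial x^c}=0$ ($F$ holomorphic); $\mathcal{SR}(\Omega)$ is the set of slice-regular functions. $f\in\mathcal{S}^1(\Omega)$ is anti-slice-regular if $\frac{\partial f}{\partial x}=0$ ($F$ anti-holomorphic); $\overline{\mathcal{SR}}(\Omega)$ is the set of these. $\mathcal{SC}(\Omega)$ is the set of slice-constant functions: slice-regular $g$ with $\frac{\partial g}{\partial x}=0$. The slice product of $f=\mathcal{I}(F)$, $g=\mathcal{I}(G)$ is $f\cdot g=\mathcal{I}(FG)$, with $FG$ the pointwise product in $\mathbb{H}\otimes\mathbb{C}$; quaternions are identified with constant slice functions. For $\lambda\in\mathbb{H}$, $\exp_\lambda(x)=\sum_{n=0}^{+\infty}\frac{x^n\lambda^n}{n!}$. $f\lambda$ denotes pointwise right multiplication by $\lambda$. *)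

(* Defs.v *)
From HB Require Import structures.
From mathcomp Require Import all_boot all_order all_algebra.
From mathcomp Require Import ring lra.
From mathcomp Require Import all_classical all_reals all_analysis.

Set Implicit Arguments.
Unset Strict Implicit.
Unset Printing Implicit Defensive.

Import Order.TTheory GRing.Theory Num.Theory.
Import numFieldNormedType.Exports.

Local Open Scope classical_set_scope.
Local Open Scope ring_scope.

Record quat (R : realType) := Quat { qre : R; qim1 : R; qim2 : R; qim3 : R }.

Definition quat_tuple (R : realType) (p : quat R) : R * R * R * R :=
  (qre p, qim1 p, qim2 p, qim3 p).

Definition tuple_quat (R : realType) (t : R * R * R * R) : quat R :=
  let: (a, b, c, d) := t in Quat a b c d.

Lemma quat_tupleK (R : realType) : cancel (@quat_tuple R) (@tuple_quat R).
Proof. by case. Qed.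

HB.instance Definition _ (R : realType) :=
  Choice.copy (quat R) (can_type (@quat_tupleK R)).

Section QuaternionAlgebra.
Variable R : realType.
Implicit Types (k : R) (p q r : quat R).

Definition qzero : quat R := Quat 0 0 0 0.
Definition qone : quat R := Quat 1 0 0 0.

Definition qopp p : quat R := Quat (- qre p) (- qim1 p) (- qim2 p) (- qim3 p).

Definition qadd p q : quat R :=
  Quat (qre p + qre q) (qim1 p + qim1 q) (qim2 p + qim2 q) (qim3 p + qim3 q).

Definition qmul p q : quat R :=
  let: Quat a b c d := p in
  let: Quat a' b' c' d' := q in
  Quat (a * a' - b * b' - c * c' - d * d')
       (a * b' + b * a' + c * d' - d * c')
       (a * c' - b * d' + c * a' + d * b')
       (a * d' + b * c' - c * b' + d * a').

Definition qscale k p : quat R :=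
  Quat (k * qre p) (k * qim1 p) (k * qim2 p) (k * qim3 p).

Definition qnorm p : R :=
  Num.sqrt (qre p ^+ 2 + qim1 p ^+ 2 + qim2 p ^+ 2 + qim3 p ^+ 2).

Lemma quat_eq (a b c d a' b' c' d' : R) :
  a = a' -> b = b' -> c = c' -> d = d' -> Quat a b c d = Quat a' b' c' d'.
Proof. by move=> -> -> -> ->. Qed.

Lemma qaddA : associative qadd.
Proof. by move=> p q r; apply: quat_eq; rewrite /= addrA. Qed.

Lemma qaddC : commutative qadd.
Proof. by move=> p q; apply: quat_eq; rewrite /= addrC. Qed.

Lemma qadd0 : left_id qzero qadd.
Proof. by case=> a b c d; apply: quat_eq; rewrite /= add0r. Qed.

Lemma qaddN : left_inverse qzero qopp qadd.
Proof. by move=> p; apply: quat_eq; rewrite /= addNr. Qed.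

HB.instance Definition _ :=
  GRing.isZmodule.Build (quat R) qaddA qaddC qadd0 qaddN.

Lemma qmulA : associative qmul.
Proof. by case=> a b c d [a' b' c' d'] [e f g h]; apply: quat_eq; ring. Qed.

Lemma qmul1q : left_id qone qmul.
Proof. by case=> a b c d; apply: quat_eq; ring. Qed.

Lemma qmulq1 : right_id qone qmul.
Proof. by case=> a b c d; apply: quat_eq; ring. Qed.

Lemma qmulDl : left_distributive qmul qadd.
Proof.
by case=> a b c d [a' b' c' d'] [e f g h]; apply: quat_eq => /=; ring.
Qed.

Lemma qmulDr : right_distributive qmul qadd.
Proof.
by case=> a b c d [a' b' c' d'] [e f g h]; apply: quat_eq => /=; ring.
Qed.

Lemma qone_neq0 : qone != qzero.
Proof. by apply/eqP => -[] /eqP; rewrite oner_eq0. Qed.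

HB.instance Definition _ :=
  GRing.Zmodule_isNzRing.Build (quat R) qmulA qmul1q qmulq1 qmulDl qmulDr
    qone_neq0.

Lemma qscaleA k l p : qscale k (qscale l p) = qscale (k * l) p.
Proof. by apply: quat_eq; rewrite /= mulrA. Qed.

Lemma qscale1 : left_id 1 qscale.
Proof. by case=> a b c d; apply: quat_eq; rewrite /= mul1r. Qed.

Lemma qscaleDr : right_distributive qscale +%R.
Proof. by move=> k p q; apply: quat_eq; rewrite /= mulrDr. Qed.

Lemma qscaleDl p : {morph qscale^~ p : k l / k + l}.
Proof. by move=> k l; apply: quat_eq; rewrite /= mulrDl. Qed.

HB.instance Definition _ :=
  GRing.Zmodule_isLmodule.Build R (quat R) qscaleA qscale1 qscaleDr qscaleDl.

Lemma qscaleAl k p q : qscale k (qmul p q) = qmul (qscale k p) q.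
Proof. by case: p q => a b c d [a' b' c' d']; apply: quat_eq => /=; ring. Qed.

HB.instance Definition _ := GRing.Lmodule_isLalgebra.Build R (quat R) qscaleAl.

Lemma qscaleAr k p q : qscale k (qmul p q) = qmul p (qscale k q).
Proof. by case: p q => a b c d [a' b' c' d']; apply: quat_eq => /=; ring. Qed.

HB.instance Definition _ := GRing.Lalgebra_isAlgebra.Build R (quat R) qscaleAr.

Lemma qnorm_triangle p q : qnorm (p + q) <= qnorm p + qnorm q.
Proof.
case: p q => a b c d [a' b' c' d']; rewrite /qnorm /=.
set u := a ^+ 2 + _ + _ + _; set v := a' ^+ 2 + _ + _ + _.
have u0 : 0 <= u by rewrite !addr_ge0 ?sqr_ge0.
have v0 : 0 <= v by rewrite !addr_ge0 ?sqr_ge0.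
rewrite -(@ler_pXn2r _ 2) ?nnegrE ?addr_ge0 ?sqrtr_ge0//.
rewrite sqr_sqrtr ?addr_ge0 ?sqr_ge0// [leRHS]sqrrD !sqr_sqrtr//.
suff : a * a' + b * b' + c * c' + d * d' <= Num.sqrt u * Num.sqrt v.
  by move: (Num.sqrt u * Num.sqrt v) => w; rewrite /u /v; lra.
rewrite -sqrtrM// (le_trans (ler_norm _))// -sqrtr_sqr ler_wsqrtr//.
rewrite -subr_ge0 (_ : _ - _ =
  (a * b' - b * a') ^+ 2 + (a * c' - c * a') ^+ 2 + (a * d' - d * a') ^+ 2 +
  (b * c' - c * b') ^+ 2 + (b * d' - d * b') ^+ 2 + (c * d' - d * c') ^+ 2).
  by rewrite !addr_ge0 ?sqr_ge0.
by rewrite /u /v; ring.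
Qed.

Lemma qnormZ k p : qnorm (k *: p) = `|k| * qnorm p.
Proof.
by rewrite /qnorm /= !exprMn -!mulrDr sqrtrM ?sqr_ge0// sqrtr_sqr.
Qed.

Lemma qnorm_eq0 p : qnorm p = 0 -> p = 0.
Proof.
case: p => a b c d /eqP; rewrite sqrtr_eq0 /= => h.
move: (sqr_ge0 a) (sqr_ge0 b) (sqr_ge0 c) (sqr_ge0 d) => ha hb hc hd.
by apply: (@quat_eq a b c d 0 0 0 0); apply/eqP;
  rewrite -sqrf_eq0 eq_le; apply/andP; split; lra.
Qed.

HB.instance Definition _ :=
  Lmodule_isNormed.Build R (quat R) qnorm_triangle qnormZ qnorm_eq0.

End QuaternionAlgebra.

(* The algebra H (x)_R C: [CQuat a b] stands for a + iota b, where iota is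
   central and iota^2 = -1. *)
Record cquat (R : realType) := CQuat { cqre : quat R; cqim : quat R }.

Definition cquat_pair (R : realType) (u : cquat R) : quat R * quat R :=
  (cqre u, cqim u).

Definition pair_cquat (R : realType) (t : quat R * quat R) : cquat R :=
  CQuat t.1 t.2.

Lemma cquat_pairK (R : realType) : cancel (@cquat_pair R) (@pair_cquat R).
Proof. by case. Qed.

HB.instance Definition _ (R : realType) :=
  Choice.copy (cquat R) (can_type (@cquat_pairK R)).

Section ComplexifiedQuaternionAlgebra.
Variable R : realType.
Implicit Types (k : R) (u v w : cquat R).

Definition cqzero : cquat R := CQuat 0 0.
Definition cqone : cquat R := CQuat 1 0.
Definition cqi : cquat R := CQuat 0 1.

Definition cqconj u : cquat R := CQuat (cqre u) (- cqim u).

Definition cqopp u : cquat R := CQuat (- cqre u) (- cqim u).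

Definition cqadd u v : cquat R := CQuat (cqre u + cqre v) (cqim u + cqim v).

Definition cqmul u v : cquat R :=
  CQuat (cqre u * cqre v - cqim u * cqim v) (cqre u * cqim v + cqim u * cqre v).

Definition cqscale k u : cquat R := CQuat (k *: cqre u) (k *: cqim u).

(* Any norm would do: only the topology of this finite-dimensional space is
   used. *)
Definition cqnorm u : R := `|cqre u| + `|cqim u|.

Lemma cquat_eq (a b a' b' : quat R) :
  a = a' -> b = b' -> CQuat a b = CQuat a' b'.
Proof. by move=> -> ->. Qed.

Lemma cqaddA : associative cqadd.
Proof. by move=> u v w; apply: cquat_eq; rewrite /= addrA. Qed.

Lemma cqaddC : commutative cqadd.
Proof. by move=> u v; apply: cquat_eq; rewrite /= addrC. Qed.

Lemma cqadd0 : left_id cqzero cqadd.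
Proof. by case=> a b; apply: cquat_eq; rewrite /= add0r. Qed.

Lemma cqaddN : left_inverse cqzero cqopp cqadd.
Proof. by move=> u; apply: cquat_eq; rewrite /= addNr. Qed.

HB.instance Definition _ :=
  GRing.isZmodule.Build (cquat R) cqaddA cqaddC cqadd0 cqaddN.

Lemma cqmulA : associative cqmul.
Proof.
case=> a b [c d] [e f]; rewrite /cqmul /=.
by apply: cquat_eq;
  rewrite !(mulrDl, mulrDr, mulNr, mulrN, opprD, mulrA) !addrA;
  rewrite addrAC; congr (_ + _); exact: addrAC.
Qed.

Lemma cqmul1q : left_id cqone cqmul.
Proof. by case=> a b; rewrite /cqmul /= !mul1r !mul0r subr0 addr0. Qed.

Lemma cqmulq1 : right_id cqone cqmul.
Proof. by case=> a b; rewrite /cqmul /= !mulr1 !mulr0 subr0 add0r. Qed.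

Lemma cqmulDl : left_distributive cqmul cqadd.
Proof.
by move=> u v w; apply: cquat_eq; rewrite /= !mulrDl ?opprD addrACA.
Qed.

Lemma cqmulDr : right_distributive cqmul cqadd.
Proof.
by move=> u v w; apply: cquat_eq; rewrite /= !mulrDr ?opprD addrACA.
Qed.

Lemma cqone_neq0 : cqone != cqzero.
Proof. by apply/eqP => -[] /eqP; rewrite oner_eq0. Qed.

HB.instance Definition _ :=
  GRing.Zmodule_isNzRing.Build (cquat R) cqmulA cqmul1q cqmulq1 cqmulDl cqmulDr
    cqone_neq0.

Lemma cqscaleA k l u : cqscale k (cqscale l u) = cqscale (k * l) u.
Proof. by apply: cquat_eq; rewrite /= scalerA. Qed.

Lemma cqscale1 : left_id 1 cqscale.
Proof. by case=> a b; apply: cquat_eq; rewrite /= scale1r. Qed.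

Lemma cqscaleDr : right_distributive cqscale +%R.
Proof. by move=> k u v; apply: cquat_eq; rewrite /= scalerDr. Qed.

Lemma cqscaleDl u : {morph cqscale^~ u : k l / k + l}.
Proof. by move=> k l; apply: cquat_eq; rewrite /= scalerDl. Qed.

HB.instance Definition _ :=
  GRing.Zmodule_isLmodule.Build R (cquat R) cqscaleA cqscale1 cqscaleDr
    cqscaleDl.

Lemma cqscaleAl k u v : cqscale k (cqmul u v) = cqmul (cqscale k u) v.
Proof.
by apply: cquat_eq; rewrite /= ?(scalerBr, scalerDr) !scalerAl.
Qed.

HB.instance Definition _ :=
  GRing.Lmodule_isLalgebra.Build R (cquat R) cqscaleAl.

Lemma cqscaleAr k u v : cqscale k (cqmul u v) = cqmul u (cqscale k v).
Proof.
by apply: cquat_eq; rewrite /= ?(scalerBr, scalerDr) !scalerAr.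
Qed.

HB.instance Definition _ :=
  GRing.Lalgebra_isAlgebra.Build R (cquat R) cqscaleAr.

Lemma cqnorm_triangle u v : cqnorm (u + v) <= cqnorm u + cqnorm v.
Proof. by rewrite /cqnorm addrACA lerD ?ler_normD. Qed.

Lemma cqnormZ k u : cqnorm (k *: u) = `|k| * cqnorm u.
Proof. by rewrite /cqnorm /= !normrZ mulrDr. Qed.

Lemma cqnorm_eq0 u : cqnorm u = 0 -> u = 0.
Proof.
case: u => a b /eqP; rewrite /cqnorm paddr_eq0 ?normr_ge0//= !normr_eq0.
by move=> /andP[/eqP -> /eqP ->].
Qed.

HB.instance Definition _ :=
  Lmodule_isNormed.Build R (cquat R) cqnorm_triangle cqnormZ cqnorm_eq0.

End ComplexifiedQuaternionAlgebra.

Arguments cqi {R}.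

Section SliceFunctions.
Variable R : realType.

(* The complex plane is R * R, with alpha + i beta written (alpha, beta). *)
Implicit Types (D : set (R * R)) (F G : R * R -> cquat R).
Implicit Types (f g h : quat R -> quat R).

Definition cconj (z : R * R) : R * R := (z.1, - z.2).

Definition imag_unit (J : quat R) : Prop := J * J = -1.

Definition slice_point (J : quat R) (z : R * R) : quat R :=
  z.1%:A + z.2 *: J.

Definition circularization D : set (quat R) :=
  [set x | exists z J, [/\ D z, imag_unit J & x = slice_point J z]].

Definition axially_symmetric_domain D : Prop :=
  [/\ open D, (forall z, D z -> D (cconj z)),
      open (circularization D) & connected (circularization D)].

Definition slice_domain D : Prop :=
  axially_symmetric_domain D /\ exists a : R, circularization D a%:A.

Definition stem_function D F : Prop :=
  forall z, D z -> F (cconj z) = cqconj (F z).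

(* f = I(F) on the circularization of D.  The stem function F is determined on
   D by the restriction of f to the circularization, so each existential
   quantifier over stem functions below designates the stem function of f. *)
Definition induces D F f : Prop :=
  stem_function D F /\
  forall z J, D z -> imag_unit J ->
    f (slice_point J z) = cqre (F z) + J * cqim (F z).

Definition partial_alpha F (z : R * R) : cquat R := 'D_((1, 0) : R * R) F z.
Definition partial_beta F (z : R * R) : cquat R := 'D_((0, 1) : R * R) F z.

Definition class_C1 D F : Prop :=
  forall z, D z ->
    [/\ derivable F z (1, 0), derivable F z (0, 1),
        {for z, continuous (partial_alpha F)} &
        {for z, continuous (partial_beta F)}].

Definition dz F (z : R * R) : cquat R :=
  2^-1 *: (partial_alpha F z - cqi * partial_beta F z).
Definition dzbar F (z : R * R) : cquat R :=
  2^-1 *: (partial_alpha F z + cqi * partial_beta F z).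

Definition slice_C1 D f : Prop := exists F, class_C1 D F /\ induces D F f.

(* [slice_dx D f h]: f is in S^1 and its slice derivative df/dx is h;
   [slice_dxc] is the same for df/dx^c. *)
Definition slice_dx D f h : Prop :=
  exists F, [/\ class_C1 D F, induces D F f & induces D (dz F) h].
Definition slice_dxc D f h : Prop :=
  exists F, [/\ class_C1 D F, induces D F f & induces D (dzbar F) h].

Definition slice_regular D f : Prop := slice_dxc D f (cst 0).
Definition anti_slice_regular D f : Prop := slice_dx D f (cst 0).
Definition slice_constant D f : Prop :=
  slice_regular D f /\ slice_dx D f (cst 0).

(* [slice_product D f g h]: f and g are slice functions and h = f . g. *)
Definition slice_product D f g h : Prop :=
  exists F G, [/\ induces D F f, induces D G g & induces D (F \* G) h].

Definition qexp (l x : quat R) : quat R :=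
  limn (series (fun n => (n`!%:R : R)^-1 *: (x ^+ n * l ^+ n))).

End SliceFunctions.

(* Main.v *)
Require Import Defs.
From HB Require Import structures.
From mathcomp Require Import all_boot all_order all_algebra.
From mathcomp Require Import ring lra.
From mathcomp Require Import all_classical all_reals all_analysis.
Import Order.TTheory GRing.Theory Num.Theory.
Import numFieldNormedType.Exports.
Local Open Scope classical_set_scope.
Local Open Scope ring_scope.

(* The stem function E of exp_l is z |-> exp (z l) in H (x) C. It is holomorphic,
   satisfies dE/dz = E l, and has as pointwise inverse the stem function of
   exp_(-l). Hence F |-> F E^-1 turns dF/dz = F l into dG/dz = 0 and, E being
   holomorphic, preserves holomorphy. To handle E concretely, write l = a + s u
   with u an imaginary unit: the commutative algebra R[iota, u] is a product of two
   copies of C, so E is given by two complex exponentials, exp (z (a + i s)) and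
   exp (z (a - i s)). On a slice domain, a slice-constant function has a locally
   constant stem function, H-valued on the real axis; the circularization of the
   locus where the stem function takes that value is clopen. *)

(** * The complex exponential series *)

Definition cmul {R : realType} (c d : R * R) : R * R :=
  (c.1 * d.1 - c.2 * d.2, c.1 * d.2 + c.2 * d.1).

Definition cpow {R : realType} (c : R * R) (n : nat) : R * R :=
  iter n (cmul c) (1, 0).

Definition cexp {R : realType} (c : R * R) : R * R :=
  (expR c.1 * cos c.2, expR c.1 * sin c.2).

Lemma cpow_mul {R : realType} (c d : R * R) n :
  cpow (cmul c d) n = cmul (cpow c n) (cpow d n).
Proof.
elim: n => [|n IH]; first by rewrite /cmul /= !mulr0 !mul0r mulr1 subr0 addr0.
rewrite /cpow !iterS -!/(cpow _ n) IH.
by rewrite /cmul /=; congr pair; ring.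
Qed.

Lemma cpow_conj {R : realType} (c : R * R) n :
  cpow (cconj c) n = cconj (cpow c n).
Proof.
elim: n => [|n IH]; first by rewrite /cconj /= oppr0.
rewrite /cpow !iterS -!/(cpow _ n) IH.
by rewrite /cmul /cconj /=; congr pair; ring.
Qed.

(** The l^1 norm is submultiplicative for [cmul], so induction bounds the sum of the absolute values
    of both parts, and each part lies below that sum. *)
Lemma cpow_norm_le {R : realType} (c : R * R) n :
  `|(cpow c n).1| <= (`|c.1| + `|c.2|) ^+ n /\
  `|(cpow c n).2| <= (`|c.1| + `|c.2|) ^+ n.
Proof.
suff : `|(cpow c n).1| + `|(cpow c n).2| <= (`|c.1| + `|c.2|) ^+ n.
  move=> h; split; apply: le_trans h.
    by rewrite lerDl.
  by rewrite lerDr.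
elim: n => [|n IH]; first by rewrite /= normr1 normr0 addr0 expr0.
rewrite exprS; apply: le_trans (_ : _ <= _ * (`|(cpow c n).1| + `|(cpow c n).2|)) _.
  rewrite /cpow iterS -/(cpow c n) /cmul /=.
  apply: le_trans (lerD (ler_normB _ _) (ler_normD _ _)) _.
  have key (a b u v : R) : a * u + b * v + (a * v + b * u) = (a + b) * (u + v).
    by ring.
  by rewrite !normrM key.
by rewrite ler_wpM2l ?addr_ge0.
Qed.

(** Comparison with [M] times the exponential series at r|x|. *)
Lemma is_cvg_pseries_fact {R : realType} (a : R ^nat) (M r x : R) :
    0 <= r -> (forall n, `|a n| <= M * r ^+ n) ->
  cvgn (pseries (fun n => a n / n`!%:R) x).
Proof.
move=> r0 ha; apply: normed_cvg.
have M0 : 0 <= M by have := ha 0%N; rewrite expr0 mulr1; apply: le_trans.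
apply: (@series_le_cvg _ _ (M *: exp_coeff (r * `|x|))) => [n|n|n|].
- exact: normr_ge0.
- by rewrite fctE mulr_ge0// exp_coeff_ge0// mulr_ge0.
- rewrite fctE /GRing.scale /exp_coeff /= !normrM normfV normr_nat normrX.
  rewrite exprMn mulrAC !mulrA ler_pM2r ?invr_gt0 ?ltr0n ?fact_gt0//.
  by rewrite ler_wpM2r ?exprn_ge0.
- exact/is_cvg_seriesZ/is_cvg_series_exp_coeff.
Qed.

Lemma pseries_diffs_fact {R : realType} (a : R ^nat) :
  pseries_diffs (fun n => a n / n`!%:R) = (fun n => a n.+1 / n`!%:R).
Proof.
apply/funext => n; rewrite /pseries_diffs factS natrM invfM.
by rewrite mulrCA mulVKf ?pnatr_eq0.
Qed.

(** Termwise differentiation asks for convergence, at |x| + 1, of the series and of its first two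
    formal derivatives. Thanks to the factorials a formal derivative only shifts the coefficients,
    and a shift by k costs a factor r^k in the bound, so one estimate covers all three series. *)
Lemma is_derive_pseries_fact {R : realType} (a : R ^nat) (r x : R) :
    0 <= r -> (forall n, `|a n| <= r ^+ n) ->
  is_derive x (1 : R) (fun t => limn (pseries (fun n => a n / n`!%:R) t))
    (limn (pseries (fun n => a n.+1 / n`!%:R) x)).
Proof.
move=> r0 ha; rewrite -pseries_diffs_fact.
have hc k y : cvgn (pseries (fun n => a (k + n)%N / n`!%:R) y).
  apply: (@is_cvg_pseries_fact _ _ (r ^+ k) r) => // n.
  by rewrite -exprD.
apply: (@pseries_snd_diffs _ _ (`|x| + 1)).
- exact: (hc 0%N).
- by rewrite pseries_diffs_fact; exact: (hc 1%N).
- by rewrite !pseries_diffs_fact; exact: (hc 2%N).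
- by rewrite [ltRHS]ger0_norm ?addr_ge0// ltrDl.
Qed.

(** Let P + iQ be the sum of (ct)^n / n! as a function of a real variable t. It solves y' = cy with
    y(0) = 1, so its product with exp(-ct), written with [expR], [cos] and [sin], has derivative
    zero and equals 1. The claim is the case t = 1. *)
Lemma cvg_cexp {R : realType} (c : R * R) :
  (series (fun n => (cpow c n).1 / n`!%:R) @ \oo --> (cexp c).1) /\
  (series (fun n => (cpow c n).2 / n`!%:R) @ \oo --> (cexp c).2).
Proof.
pose u n := (cpow c n).1; pose v n := (cpow c n).2.
pose r := `|c.1| + `|c.2|.
have r0 : 0 <= r by exact: addr_ge0.
have hu n : `|u n| <= r ^+ n by case: (cpow_norm_le c n).
have hv n : `|v n| <= r ^+ n by case: (cpow_norm_le c n).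
pose P (t : R) : R := limn (pseries (fun n => u n / n`!%:R) t).
pose Q (t : R) : R := limn (pseries (fun n => v n / n`!%:R) t).
have cP t : cvgn (pseries (fun n => u n / n`!%:R) t).
  by apply: (@is_cvg_pseries_fact _ _ 1 r) => // n; rewrite mul1r.
have cQ t : cvgn (pseries (fun n => v n / n`!%:R) t).
  by apply: (@is_cvg_pseries_fact _ _ 1 r) => // n; rewrite mul1r.
have dP t : is_derive t (1 : R) P (c.1 * P t - c.2 * Q t).
  apply: is_derive_eq (is_derive_pseries_fact _ _ _ r0 hu) _.
  rewrite -[c.1 * _](lim_seriesZ c.1 (cP t)) -[c.2 * _](lim_seriesZ c.2 (cQ t)).
  rewrite -lim_seriesB; [|exact/is_cvg_seriesZ/cP|exact/is_cvg_seriesZ/cQ].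
  congr (limn (series _)); apply/funext => n.
  by rewrite /u /v !fctE /GRing.scale /= /cmul /=; ring.
have dQ t : is_derive t (1 : R) Q (c.1 * Q t + c.2 * P t).
  apply: is_derive_eq (is_derive_pseries_fact _ _ _ r0 hv) _.
  rewrite -[c.1 * _](lim_seriesZ c.1 (cQ t)) -[c.2 * _](lim_seriesZ c.2 (cP t)).
  rewrite -lim_seriesD; [|exact/is_cvg_seriesZ/cQ|exact/is_cvg_seriesZ/cP].
  congr (limn (series _)); apply/funext => n.
  by rewrite /u /v !fctE /GRing.scale /= /cmul /=; ring.
have P0 : P 0 = 1.
  (* At 0 only the term of index 0 survives; the shift by one skips the empty partial sum. *)
  apply/cvg_lim => //; rewrite -(cvg_shiftn 1).
  rewrite (_ : (fun n => _) = cst 1); first exact: cvg_cst.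
  apply/funext => n; rewrite /pseries /series /= addn1 big_nat_recl// big1_seq.
    by rewrite /u /= expr0 fact0 invr1 !mulr1 addr0.
  by move=> i _; rewrite exprS mul0r mulr0.
have Q0 : Q 0 = 0.
  apply/cvg_lim => //; rewrite -(cvg_shiftn 1).
  rewrite (_ : (fun n => _) = cst 0); first exact: cvg_cst.
  apply/funext => n; rewrite /pseries /series /= addn1 big_nat_recl// big1_seq.
    by rewrite /v /= mul0r mul0r addr0.
  by move=> i _; rewrite exprS mul0r mulr0.
pose e (t : R) := expR (- c.1 * t).
pose C (t : R) := cos (c.2 * t).
pose S (t : R) := sin (c.2 * t).
have de t : is_derive t (1 : R) e (- c.1 * e t).
  apply: trigger_derive; rewrite /e /GRing.scale /=; ring.
have dC t : is_derive t (1 : R) C (- c.2 * S t).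
  apply: trigger_derive; rewrite /S /GRing.scale /=; ring.
have dS t : is_derive t (1 : R) S (c.2 * C t).
  apply: trigger_derive; rewrite /C /GRing.scale /=; ring.
have e0 : e 0 = 1 by rewrite /e mulr0 expR0.
have C0 : C 0 = 1 by rewrite /C mulr0 cos0.
have S0 : S 0 = 0 by rewrite /S mulr0 sin0.
(* [E1] and [E2] are the real and imaginary parts of exp(-c)(P(1) + iQ(1)) = 1; multiplying back by
   exp(c) yields [EP] and [EQ]. *)
have E1 : e 1 * (C 1 * P 1 + S 1 * Q 1) = 1.
  transitivity (e 0 * (C 0 * P 0 + S 0 * Q 0)); last first.
    by rewrite e0 C0 S0 P0 Q0; ring.
  apply: (@is_derive_0_is_cst _ (e * (C * P + S * Q))) => t.
  by apply: trigger_derive; rewrite /GRing.scale /= !fctE; ring.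
have E2 : e 1 * (C 1 * Q 1 - S 1 * P 1) = 0.
  transitivity (e 0 * (C 0 * Q 0 - S 0 * P 0)); last first.
    by rewrite e0 C0 S0 P0 Q0; ring.
  apply: (@is_derive_0_is_cst _ (e * (C * Q - S * P))) => t.
  by apply: trigger_derive; rewrite /GRing.scale /= !fctE; ring.
have eE : expR c.1 * e 1 = 1 by rewrite /e mulr1 expRxMexpNx_1.
have CS : C 1 ^+ 2 + S 1 ^+ 2 = 1 by rewrite cos2Dsin2.
have EP : P 1 = expR c.1 * C 1.
  transitivity ((expR c.1 * e 1) * (C 1 ^+ 2 + S 1 ^+ 2) * P 1).
    by rewrite eE CS !mul1r.
  transitivity (expR c.1 * (C 1 * (e 1 * (C 1 * P 1 + S 1 * Q 1)) -
                            S 1 * (e 1 * (C 1 * Q 1 - S 1 * P 1)))); first ring.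
  by rewrite E1 E2 mulr1 mulr0 subr0.
have EQ : Q 1 = expR c.1 * S 1.
  transitivity ((expR c.1 * e 1) * (C 1 ^+ 2 + S 1 ^+ 2) * Q 1).
    by rewrite eE CS !mul1r.
  transitivity (expR c.1 * (S 1 * (e 1 * (C 1 * P 1 + S 1 * Q 1)) +
                            C 1 * (e 1 * (C 1 * Q 1 - S 1 * P 1)))); first ring.
  by rewrite E1 E2 mulr1 mulr0 addr0.
have pE a : pseries a (1 : R) = series a.
  by rewrite /pseries; congr series; apply/funext => n; rewrite /= expr1n mulr1.
rewrite /cexp /=; rewrite /C /S !mulr1 in EP EQ; rewrite -EP -EQ -!pE.
by split; [exact: cP|exact: cQ].
Qed.

(** * Calculus in the complexified quaternions *)

Lemma quat_normM {R : realType} (p q : quat R) : `|p * q| = `|p| * `|q|.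
Proof.
case: p q => a b c d [a' b' c' d'].
rewrite -!/(qnorm _) /qnorm -sqrtrM ?addr_ge0 ?sqr_ge0//; congr Num.sqrt.
by rewrite /=; ring.
Qed.

Lemma cquat_normE {R : realType} (u : cquat R) : `|u| = `|cqre u| + `|cqim u|.
Proof. by []. Qed.

Lemma cquat_normM_le {R : realType} (u v : cquat R) : `|u * v| <= `|u| * `|v|.
Proof.
rewrite !cquat_normE /=.
apply: le_trans (lerD (ler_normB _ _) (ler_normD _ _)) _.
rewrite !quat_normM.
have key (a b c d : R) : a * c + b * d + (a * d + b * c) = (a + b) * (c + d).
  by ring.
by rewrite key.
Qed.

(** The usual splitting fg - ab = (f - a)g + a(g - b), estimated with the submultiplicative norm. *)
Lemma cvg_cquatM {R : realType} {T : Type} {F : set_system T}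
    {FF : Filter F} (f g : T -> cquat R) (a b : cquat R) :
  f @ F --> a -> g @ F --> b -> f x * g x @[x --> F] --> a * b.
Proof.
move=> fa gb; apply/subr_cvg0/norm_cvg0P.
have fa0 : `|f x - a| @[x --> F] --> (0 : R).
  by apply/norm_cvg0P/subr_cvg0.
have gb0 : `|g x - b| @[x --> F] --> (0 : R).
  by apply/norm_cvg0P/subr_cvg0.
apply: (@squeeze_cvgr _ _ _ _ (cst 0)
  (fun x => `|f x - a| * `|g x| + `|a| * `|g x - b|)).
- near=> x; rewrite normr_ge0 /=.
  rewrite (_ : f x * g x - a * b = (f x - a) * g x + a * (g x - b)).
    by apply: le_trans (ler_normD _ _) _; rewrite lerD ?cquat_normM_le.
  by rewrite mulrBl mulrBr addrA subrK.
- exact: cvg_cst.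
- rewrite (_ : (0 : R) = 0 * `|b| + `|a| * 0); last by rewrite mul0r mulr0 addr0.
  apply: cvgD; first by apply: cvgM => //; exact: cvg_norm.
  by apply: cvgM => //; exact: cvg_cst.
Unshelve. all: by end_near. Qed.

Lemma is_derive_cquatM {R : realType} {V : normedModType R}
    (f g : V -> cquat R) (x v : V) (df dg : cquat R) :
    is_derive x v f df -> is_derive x v g dg ->
  is_derive x v (f \* g) (df * g x + f x * dg).
Proof.
move=> [fx <-] [gx <-].
have lim : (fun h : R => h^-1 *: (((f \* g) \o shift x) (h *: v) - (f \* g) x))
    @ 0^' --> 'D_v f x * g x + f x * 'D_v g x.
  rewrite [X in X @ _](_ : _ = (fun h : R =>
      (h^-1 *: ((f \o shift x) (h *: v) - f x)) * g (h *: v + x) +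
      f x * (h^-1 *: ((g \o shift x) (h *: v) - g x)))); last first.
    apply/funext => h /=; rewrite -scalerAl -scalerAr -scalerDr; congr (_ *: _).
    by rewrite mulrBl mulrBr addrA subrK.
  apply: cvgD; last by apply: cvg_cquatM; [exact: cvg_cst|exact: gx].
  apply: cvg_cquatM; first exact: fx.
  (* Only continuity of [g] along the line through [x] in direction [v] enters here, and
     derivability in that direction gives it. *)
  suff : {for 0, continuous (fun h : R => g (h *: v + x))}.
    by move=> /continuous_withinNx; rewrite scale0r add0r.
  exact/differentiable_continuous/derivable1_diffP/(derivable1P _ _ _).1.
apply: DeriveDef; last exact: cvg_lim lim.
by apply/cvg_ex; exists ('D_v f x * g x + f x * 'D_v g x).
Qed.

Lemma is_derive_scalel {R : realType} {V W : normedModType R} (k : V -> R)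
    (w : W) (x v : V) (dk : R) :
  is_derive x v k dk -> is_derive x v (fun y => k y *: w) (dk *: w).
Proof.
move=> [kx <-].
have lim : (fun h : R => h^-1 *: (((fun y => k y *: w) \o shift x) (h *: v) - k x *: w))
    @ 0^' --> 'D_v k x *: w.
  rewrite [X in X @ _](_ : _ =
      (fun h : R => (h^-1 *: ((k \o shift x) (h *: v) - k x)) *: w)).
    by apply: cvgZr_tmp; exact: kx.
  by apply/funext => h /=; rewrite -scalerBl scalerA.
apply: DeriveDef; last exact: cvg_lim lim.
by apply/cvg_ex; exists ('D_v k x *: w).
Qed.

(** The two difference quotients are the same function of the increment. This reduces partial
    derivatives to calculus in one real variable. *)
Lemma derivable_partial1 {R : realType} {W : normedModType R} (F : R * R -> W)
    (a b : R) :
  (derivable F (a, b) (1, 0) <-> derivable (fun t => F (t, b)) a 1) /\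
  'D_(1, 0) F (a, b) = 'D_1 (fun t => F (t, b)) a.
Proof.
have E : (fun h : R => h^-1 *: ((F \o shift (a, b)) (h *: (1, 0)) - F (a, b))) =
    (fun h : R => h^-1 *: (((fun t => F (t, b)) \o shift a) (h *: (1 : R)) - F (a, b))).
  by apply/funext => h /=; congr (_ *: (F (_, _) - _)); rewrite /= scaler0 add0r.
by rewrite /derivable /derive E.
Qed.

Lemma derivable_partial2 {R : realType} {W : normedModType R} (F : R * R -> W)
    (a b : R) :
  (derivable F (a, b) (0, 1) <-> derivable (fun t => F (a, t)) b 1) /\
  'D_(0, 1) F (a, b) = 'D_1 (fun t => F (a, t)) b.
Proof.
have E : (fun h : R => h^-1 *: ((F \o shift (a, b)) (h *: (0, 1)) - F (a, b))) =
    (fun h : R => h^-1 *: (((fun t => F (a, t)) \o shift b) (h *: (1 : R)) - F (a, b))).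
  by apply/funext => h /=; congr (_ *: (F (_, _) - _)); rewrite /= scaler0 add0r.
by rewrite /derivable /derive E.
Qed.

(** A linear functional of norm at most 1 is continuous, so it commutes with the limit of the
    difference quotients. *)
Lemma derivable_functional {R : realType} {W : normedModType R} (k : W -> R)
    (phi : R -> W) (t : R) :
    (forall u v : W, k (u - v) = k u - k v) -> (forall a u, k (a *: u) = a * k u) ->
    (forall u, `|k u| <= `|u|) ->
  derivable phi t 1 -> is_derive t (1 : R) (k \o phi) (k ('D_1 phi t)).
Proof.
move=> kB kZ kn dphi.
have kc (G : set_system R) (FG : Filter G) (f : R -> W) (a : W) :
    f @ G --> a -> k (f x) @[x --> G] --> k a.
  move=> fa; apply/cvgrPdist_le => e e0; move/cvgrPdist_le: fa => /(_ e e0).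
  by apply: filterS => x; rewrite -kB; exact: le_trans.
have lim : (fun h : R => h^-1 *: (((k \o phi) \o shift t) (h *: (1 : R)) - (k \o phi) t))
    @ 0^' --> k ('D_1 phi t).
  rewrite [X in X @ _](_ : _ =
      (fun h : R => k (h^-1 *: ((phi \o shift t) (h *: (1 : R)) - phi t)))).
    by apply: kc; exact: dphi.
  by apply/funext => h /=; rewrite kZ kB.
apply: DeriveDef; last exact: cvg_lim lim.
by apply/cvg_ex; exists (k ('D_1 phi t)).
Qed.

(** The mean value theorem holds for real-valued functions only, hence the composition with [k]. The
    disjunction on [t] leaves the order of [a] and [b] free. *)
Lemma mean_value_functional {R : realType} {W : normedModType R} (k : W -> R)
    (phi : R -> W) (a b M : R) :
    (forall u v : W, k (u - v) = k u - k v) -> (forall a u, k (a *: u) = a * k u) ->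
    (forall u, `|k u| <= `|u|) ->
    (forall t, (a <= t <= b) || (b <= t <= a) ->
      derivable phi t 1 /\ `|'D_1 phi t| <= M) ->
  `|k (phi b - phi a : W)| <= M * `|b - a|.
Proof.
move=> kB kZ kn; wlog ab : a b / a < b.
  move=> W0 H; have [ab|ba|->] := ltgtP a b.
  - exact: W0.
  - rewrite kB -opprB normrN -kB distrC; apply: W0 => // t ht; apply: H.
    by rewrite orbC.
  - by rewrite kB !subrr !normr0 mulr0.
move=> H.
have dk t : t \in `[a, b]%R -> is_derive t (1 : R) (k \o phi) (k ('D_1 phi t)).
  rewrite in_itv /= => tab; apply: derivable_functional => //.
  by have [|] := H t; rewrite ?tab.
have [|c cab] := @MVT _ (k \o phi) (fun t => k ('D_1 phi t)) _ _ ab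
  (fun t tab => dk t (subset_itv_oo_cc tab)).
  apply: derivable_within_continuous => t tab.
  by apply: ex_derive; exact: dk.
rewrite /= -kB => ->; rewrite normrM ler_wpM2r//.
apply: le_trans (kn _) _; have := subset_itv_oo_cc cab.
by rewrite in_itv /= => tab; have [|] := H c; rewrite ?tab.
Qed.

Lemma quat_norm_le {R : realType} (p : quat R) :
  `|p| <= `|qre p| + `|qim1 p| + `|qim2 p| + `|qim3 p|.
Proof.
rewrite -[leLHS]/(qnorm p) /qnorm.
have key (a b c d : R) : Num.sqrt (a ^+ 2 + b ^+ 2 + c ^+ 2 + d ^+ 2) <=
    `|a| + `|b| + `|c| + `|d|.
  rewrite -(ger0_norm (_ : 0 <= `|a| + `|b| + `|c| + `|d|)) ?addr_ge0//.
  rewrite -sqrtr_sqr ler_wsqrtr// -(real_normK (num_real a)).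
  rewrite -(real_normK (num_real b)) -(real_normK (num_real c)).
  rewrite -(real_normK (num_real d)).
  have := normr_ge0 a; have := normr_ge0 b; have := normr_ge0 c.
  have := normr_ge0 d.
  have aux (x y z w : R) : 0 <= w -> 0 <= z -> 0 <= y -> 0 <= x ->
    x ^+ 2 + y ^+ 2 + z ^+ 2 + w ^+ 2 <= (x + y + z + w) ^+ 2 by nra.
  exact: aux.
exact: key.
Qed.

Lemma quat_coord_le {R : realType} (p : quat R) :
  [/\ `|qre p| <= `|p|, `|qim1 p| <= `|p|, `|qim2 p| <= `|p| & `|qim3 p| <= `|p|].
Proof.
case: p => a b c d; rewrite -[`|Quat _ _ _ _|]/(qnorm _) /qnorm /=.
have key (x s : R) : 0 <= s -> `|x| <= Num.sqrt (x ^+ 2 + s).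
  by move=> s0; rewrite -sqrtr_sqr ler_wsqrtr// lerDl.
have sq := @sqr_ge0 R; split.
- by rewrite -!addrA; apply: key; rewrite !addr_ge0.
- by rewrite (addrC (a ^+ 2)) -!addrA; apply: key; rewrite !addr_ge0.
- by rewrite (addrC _ (c ^+ 2)) -!addrA; apply: key; rewrite !addr_ge0.
- by rewrite (addrC _ (d ^+ 2)); apply: key; rewrite !addr_ge0.
Qed.

(** The constant 8 is the real dimension of H (x) C: each of the eight coordinates is a linear
    functional of norm at most 1, to which the scalar estimate applies. *)
Lemma mean_value_cquat {R : realType} (phi : R -> cquat R) (a b M : R) :
    (forall t, (a <= t <= b) || (b <= t <= a) ->
      derivable phi t 1 /\ `|'D_1 phi t| <= M) ->
  `|phi b - phi a| <= 8 * M * `|b - a|.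
Proof.
move=> H.
have mv (k : cquat R -> R) :
    (forall u v, k (u - v) = k u - k v) -> (forall a u, k (a *: u) = a * k u) ->
    (forall u, `|k u| <= `|u|) -> `|k (phi b - phi a)| <= M * `|b - a|.
  by move=> kB kZ kn; exact: (mean_value_functional k phi a b M kB kZ kn H).
have lre (u : cquat R) : `|cqre u| <= `|u| by rewrite cquat_normE lerDl.
have lim (u : cquat R) : `|cqim u| <= `|u| by rewrite cquat_normE lerDr.
have l1 (u : cquat R) := quat_coord_le (cqre u).
have l2 (u : cquat R) := quat_coord_le (cqim u).
have m1 : forall k : quat R -> R,
    (forall p q, k (p - q) = k p - k q) -> (forall a p, k (a *: p) = a * k p) ->
    (forall p, `|k p| <= `|p|) -> `|k (cqre (phi b - phi a))| <= M * `|b - a|.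
  by move=> k kB kZ kn; apply: (mv (k \o @cqre R)) => [u v|c u|u] //=;
    exact: le_trans (kn _) (lre u).
have m2 : forall k : quat R -> R,
    (forall p q, k (p - q) = k p - k q) -> (forall a p, k (a *: p) = a * k p) ->
    (forall p, `|k p| <= `|p|) -> `|k (cqim (phi b - phi a))| <= M * `|b - a|.
  by move=> k kB kZ kn; apply: (mv (k \o @cqim R)) => [u v|c u|u] //=;
    exact: le_trans (kn _) (lim u).
rewrite cquat_normE; apply: le_trans (lerD (quat_norm_le _) (quat_norm_le _)) _.
have c0 (p : quat R) : `|qre p| <= `|p| by case: (quat_coord_le p).
have c1 (p : quat R) : `|qim1 p| <= `|p| by case: (quat_coord_le p).
have c2 (p : quat R) : `|qim2 p| <= `|p| by case: (quat_coord_le p).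
have c3 (p : quat R) : `|qim3 p| <= `|p| by case: (quat_coord_le p).
have e8 (x : R) : 8 * x = x + x + x + x + (x + x + x + x) by ring.
by rewrite -mulrA e8; do ?apply: lerD; (apply: m1 || apply: m2).
Qed.

(** * C^1 functions of two real variables *)

Lemma ball_pairE {R : realType} (z w : R * R) (r : R) :
  ball z r w <-> `|z.1 - w.1| < r /\ `|z.2 - w.2| < r.
Proof. by []. Qed.

(** A horizontal and then a vertical segment lead from [z] to [w]; both stay in the ball, which is a
    square for the product norm. *)
Lemma partials_lipschitz {R : realType} (F : R * R -> cquat R) (z : R * R)
    (r M : R) :
    (forall w, ball z r w -> [/\ derivable F w (1, 0), derivable F w (0, 1),
      `|partial_alpha F w| <= M & `|partial_beta F w| <= M]) ->
  forall w, ball z r w ->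
    `|F w - F z| <= 8 * M * (`|w.1 - z.1| + `|w.2 - z.2|).
Proof.
case: z => a b H [c d] /ball_pairE[/= ac bd].
have between (x y t : R) : `|x - y| < r -> (x <= t <= y) || (y <= t <= x) ->
    `|x - t| < r.
  move=> xy p; apply: le_lt_trans xy; case/orP: p => /andP[h1 h2].
    by rewrite distrC [leRHS]distrC !ger0_norm ?subr_ge0 ?lerD2r// (le_trans h1 h2).
  by rewrite !ger0_norm ?subr_ge0 ?lerD2l ?lerN2// (le_trans h1 h2).
have r0 : 0 < r by exact: le_lt_trans ac.
rewrite (_ : F _ - F _ = (F (c, d) - F (c, b)) + (F (c, b) - F (a, b))); last first.
  by rewrite addrA subrK.
apply: le_trans (ler_normD _ _) _; rewrite mulrDr addrC lerD//=.
- apply: (mean_value_cquat (fun t => F (t, b))) => t tac.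
  have [|h1 _ h2 _] := H (t, b).
    by apply/ball_pairE; split => /=; [exact: between tac|rewrite subrr normr0].
  by have [e1 e2] := derivable_partial1 F t b; rewrite -e2 -e1.
- apply: (mean_value_cquat (fun t => F (c, t))) => t tbd.
  have [|_ h1 _ h2] := H (c, t).
    by apply/ball_pairE; split => /=; [|exact: between tbd].
  by have [e1 e2] := derivable_partial2 F c t; rewrite -e2 -e1.
Qed.

Lemma open_near {R : realType} {D : set (R * R)} {z : R * R} :
  open D -> D z -> \forall w \near z, D w.
Proof. by move=> oD Dz; exact: open_nbhs_nbhs. Qed.

(** [class_C1] speaks of the partial derivatives only. Being continuous they are bounded near [z],
    which gives a Lipschitz estimate there. *)
Lemma class_C1_continuous {R : realType} {D : set (R * R)} {F : R * R -> cquat R}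
    {z : R * R} :
  open D -> class_C1 D F -> D z -> {for z, continuous F}.
Proof.
move=> oD C1 Dz; have [_ _ ca cb] := C1 z Dz.
pose M := `|partial_alpha F z| + `|partial_beta F z| + 1.
have na : \forall w \near z, `|partial_alpha F w| < M.
  apply: (cvgr_norm_lt _ ca); rewrite /M -addrA ltrDl.
  by rewrite ltr_wpDl.
have nb : \forall w \near z, `|partial_beta F w| < M.
  apply: (cvgr_norm_lt _ cb); rewrite /M -addrA addrCA ltrDl.
  by rewrite ltr_wpDl.
have nD := open_near oD Dz.
have : \forall w \near z, [/\ derivable F w (1, 0), derivable F w (0, 1),
      `|partial_alpha F w| <= M & `|partial_beta F w| <= M].
  apply: filterS3 nD na nb => w Dw ha hb; have [d1 d2 _ _] := C1 w Dw.
  by split; [exact: d1|exact: d2|exact: ltW|exact: ltW].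
case/nbhs_ballP => r /= r0 Hr.
have lip := partials_lipschitz F z r M Hr.
apply/cvgrPdist_le => e e0.
have M0 : 0 < M by rewrite /M ltr_wpDl ?addr_ge0.
(* Two coordinate differences below this radius, times the Lipschitz constant 8M, add up to [e]. *)
have K0 : 0 < e / (16 * M) by rewrite divr_gt0// mulr_gt0.
apply: filterS2 (nbhsx_ballx z r r0) (nbhsx_ballx z _ K0) => w w1 /ball_pairE[h1 h2].
rewrite distrC; apply: le_trans (lip w w1) _.
rewrite distrC [X in _ + X]distrC.
apply: le_trans (_ : 8 * M * (e / (16 * M) + e / (16 * M)) <= _).
  by rewrite ler_wpM2l ?mulr_ge0 ?ltW// ltrD.
rewrite le_eqVlt; apply/orP; left; apply/eqP; field.
by rewrite gt_eqF.
Qed.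

Lemma partials0_locally_cst {R : realType} {D : set (R * R)} {F : R * R -> cquat R} :
    open D -> class_C1 D F ->
    (forall z, D z -> partial_alpha F z = 0 /\ partial_beta F z = 0) ->
  forall z, D z -> \forall w \near z, F w = F z.
Proof.
move=> oD C1 H z Dz; have /nbhs_ballP[r /= r0 Hr] := open_near oD Dz.
apply: filterS (nbhsx_ballx z r r0) => w zw; apply/eqP.
rewrite -subr_eq0 -normr_le0; have := partials_lipschitz F z r 0 _ w zw.
rewrite mulr0 mul0r; apply => v /Hr Dv.
by have [-> ->] := H v Dv; have [d1 d2 _ _] := C1 v Dv; rewrite normr0.
Qed.

(** * Leibniz rules for the derivatives of stem functions *)

Section Products.
Context {R : realType}.
Implicit Types (D : set (R * R)) (F G : R * R -> cquat R) (z : R * R).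

Lemma cvg_near_eq {T U : topologicalType} (f g : T -> U) (x : T) (l : U) :
  (\forall y \near x, f y = g y) -> f @ x --> l -> g @ x --> l.
Proof. by move=> fg; apply: cvg_trans; exact: near_eq_cvg. Qed.

Lemma partialM {D F G z} : class_C1 D F -> class_C1 D G -> D z ->
  partial_alpha (F \* G) z = partial_alpha F z * G z + F z * partial_alpha G z /\
  partial_beta (F \* G) z = partial_beta F z * G z + F z * partial_beta G z.
Proof.
move=> C1F C1G Dz; have [f1 f2 _ _] := C1F z Dz; have [g1 g2 _ _] := C1G z Dz.
have da := is_derive_cquatM F G z (1, 0) _ _ (derivableP f1) (derivableP g1).
have db := is_derive_cquatM F G z (0, 1) _ _ (derivableP f2) (derivableP g2).
by split; [rewrite /partial_alpha (@derive_val _ _ _ _ _ _ _ da)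
          |rewrite /partial_beta (@derive_val _ _ _ _ _ _ _ db)].
Qed.

Lemma class_C1M {D F G} : open D -> class_C1 D F -> class_C1 D G ->
  class_C1 D (F \* G).
Proof.
move=> oD C1F C1G z Dz.
have [f1 f2 f3 f4] := C1F z Dz; have [g1 g2 g3 g4] := C1G z Dz.
have cF := class_C1_continuous oD C1F Dz; have cG := class_C1_continuous oD C1G Dz.
have nD := open_near oD Dz.
split.
- by apply: ex_derive; apply: is_derive_cquatM; exact: derivableP.
- by apply: ex_derive; apply: is_derive_cquatM; exact: derivableP.
- have [E _] := partialM C1F C1G Dz; rewrite /prop_for /continuous_at E.
  apply: (@cvg_near_eq _ _ (fun w => partial_alpha F w * G w + F w * partial_alpha G w)).
    near=> w; have Dw : D w by near: w.
    by have [-> _] := partialM C1F C1G Dw.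
  exact: (cvgD (cvg_cquatM _ _ _ _ f3 cG) (cvg_cquatM _ _ _ _ cF g3)).
- have [_ E] := partialM C1F C1G Dz; rewrite /prop_for /continuous_at E.
  apply: (@cvg_near_eq _ _ (fun w => partial_beta F w * G w + F w * partial_beta G w)).
    near=> w; have Dw : D w by near: w.
    by have [_ ->] := partialM C1F C1G Dw.
  exact: (cvgD (cvg_cquatM _ _ _ _ f4 cG) (cvg_cquatM _ _ _ _ cF g4)).
Unshelve. all: by end_near. Qed.

Lemma cqiC (u : cquat R) : cqi * u = u * cqi.
Proof.
case: u => p q; apply: cquat_eq; first by rewrite /= !mul0r !mulr0 mul1r mulr1.
by rewrite /= !mul0r !mulr0 mul1r mulr1 addrC.
Qed.

Lemma cqi_sqr : cqi * cqi = -1 :> cquat R.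
Proof.
by apply: cquat_eq; rewrite /= ?mul0r ?mulr0 ?mulr1 ?sub0r ?addr0 ?oppr0.
Qed.

(** The algebra is not commutative, but iota is central and moves past [F z]; this makes [dz], and
    likewise [dzbar], a derivation. *)
Lemma dzM {D F G z} : class_C1 D F -> class_C1 D G -> D z ->
  dz (F \* G) z = dz F z * G z + F z * dz G z.
Proof.
move=> C1F C1G Dz; have [Ea Eb] := partialM C1F C1G Dz.
rewrite /dz Ea Eb -scalerAl -scalerAr -scalerDr; congr (_ *: _).
rewrite !mulrBl !mulrBr mulrDr opprD !mulrA (cqiC (F z)).
exact: addrACA.
Qed.

Lemma dzbarM {D F G z} : class_C1 D F -> class_C1 D G -> D z ->
  dzbar (F \* G) z = dzbar F z * G z + F z * dzbar G z.
Proof.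
move=> C1F C1G Dz; have [Ea Eb] := partialM C1F C1G Dz.
rewrite /dzbar Ea Eb -scalerAl -scalerAr -scalerDr; congr (_ *: _).
rewrite mulrDl !mulrDr !mulrA (cqiC (F z)).
exact: addrACA.
Qed.

Lemma partial_near_eq {D F G z} : open D -> (forall w, D w -> F w = G w) -> D z ->
  partial_alpha F z = partial_alpha G z /\ partial_beta F z = partial_beta G z.
Proof.
move=> oD FG Dz; have nFG : \forall w \near z, F w = G w.
  by apply: filterS (open_near oD Dz); exact: FG.
by split; exact: near_eq_derive.
Qed.

(** The partial derivatives are recovered as dz + dzbar and iota (dz - dzbar). *)
Lemma partials0P {F z} :
  dz F z = 0 -> dzbar F z = 0 -> partial_alpha F z = 0 /\ partial_beta F z = 0.
Proof.
move=> h1 h2; have E : 2^-1 + 2^-1 = 1 :> R by lra.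
split.
  transitivity (dz F z + dzbar F z); last by rewrite h1 h2 addr0.
  rewrite /dz /dzbar -scalerDr addrACA addNr addr0 scalerDr -scalerDl E.
  by rewrite scale1r.
transitivity (cqi * (dz F z - dzbar F z)); last by rewrite h1 h2 subr0 mulr0.
rewrite /dz /dzbar -scalerBr opprD addrACA subrr add0r -opprD -mulrDr.
rewrite scalerN mulrN -scalerAr mulrA cqi_sqr mulN1r scalerN opprK scalerDr -scalerDl E.
by rewrite scale1r.
Qed.

End Products.

(** * Imaginary units and slice coordinates *)

Section ImaginaryUnits.
Context {R : realType}.
Implicit Types (J p q u x : quat R) (z w : R * R).

Lemma imag_unitP J : imag_unit J ->
  exists b c d, J = Quat 0 b c d /\ b ^+ 2 + c ^+ 2 + d ^+ 2 = 1.
Proof.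
case: J => a b c d [] h0 h1 h2 h3.
have a0 : a = 0.
  (* The imaginary parts of J^2 = -1 read 2ab = 2ac = 2ad = 0. A nonzero [a] would leave a^2 =
     -1. *)
  apply/eqP/negPn/negP => an0.
  have z (y : R) : a * y = 0 -> y = 0.
    by move=> /eqP; rewrite mulf_eq0 (negPf an0) => /eqP.
  have b0 : b = 0 by apply: z; lra.
  have c0 : c = 0 by apply: z; lra.
  have d0 : d = 0 by apply: z; lra.
  have := sqr_ge0 a; move: h0; rewrite b0 c0 d0; lra.
by exists b, c, d; subst a; split => //; lra.
Qed.

Lemma slice_pointE J z : imag_unit J ->
  exists b c d, [/\ J = Quat 0 b c d, b ^+ 2 + c ^+ 2 + d ^+ 2 = 1 &
    slice_point J z = Quat z.1 (z.2 * b) (z.2 * c) (z.2 * d)].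
Proof.
move=> /imag_unitP[b [c [d [-> e]]]]; exists b, c, d; split => //.
by apply: quat_eq => /=; ring.
Qed.

Lemma slice_pointN J z : slice_point (- J) z = slice_point J (cconj z).
Proof. by rewrite /slice_point /= scalerN scaleNr. Qed.

Lemma imag_unitN {J} : imag_unit J -> imag_unit (- J).
Proof. by rewrite /imag_unit mulrNN. Qed.

Lemma slice_pointD J z w :
  slice_point J (z + w) = slice_point J z + slice_point J w.
Proof. by rewrite /slice_point !scalerDl addrACA. Qed.

Lemma slice_point_opp J z : slice_point J (- z) = - slice_point J z.
Proof. by rewrite /slice_point /= !scaleNr opprD. Qed.

Lemma slice_pointM J z w : imag_unit J ->
  slice_point J (cmul z w) = slice_point J z * slice_point J w.
Proof.
move=> JJ; rewrite /slice_point /cmul /= mulrDl !mulrDr -!scalerAl -!scalerAr.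
rewrite JJ !mulr1 !mul1r !scalerA scalerN scalerBl scalerDl -!addrA.
by congr (_ + _); rewrite addrC !addrA.
Qed.

Lemma slice_pointX J z n : imag_unit J ->
  slice_point J (cpow z n) = slice_point J z ^+ n.
Proof.
move=> JJ; elim: n => [|n IH].
  by rewrite /slice_point /= scale1r scale0r addr0 expr0.
by rewrite exprS -IH -slice_pointM.
Qed.

Definition imag_norm q : R :=
  Num.sqrt (qim1 q ^+ 2 + qim2 q ^+ 2 + qim3 q ^+ 2).

(** Of the two conjugate parameters of [q], the one with nonnegative second coordinate. *)
Definition slice_coord q : R * R := (qre q, imag_norm q).

(* On the real axis every imaginary unit fits; i is chosen. *)
Definition slice_dir q : quat R :=
  if imag_norm q == 0 then Quat 0 1 0 0
  else (imag_norm q)^-1 *: Quat 0 (qim1 q) (qim2 q) (qim3 q).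

Lemma imag_norm_sqr q :
  imag_norm q ^+ 2 = qim1 q ^+ 2 + qim2 q ^+ 2 + qim3 q ^+ 2.
Proof. by rewrite sqr_sqrtr// !addr_ge0 ?sqr_ge0. Qed.

Lemma slice_dir_unit q : imag_unit (slice_dir q).
Proof.
rewrite /imag_unit /slice_dir; case: eqVneq => [_|n0].
  by apply: quat_eq => /=; ring.
have e := imag_norm_sqr q; case: q n0 e => a b c d /=.
set s := imag_norm _ => s0 e.
apply: quat_eq => /=; try by ring.
by apply: (mulfI (expf_neq0 2 s0)); rewrite mulrN1 [in RHS]e; field.
Qed.

Lemma slice_dirK q : slice_point (slice_dir q) (slice_coord q) = q.
Proof.
rewrite /slice_dir /slice_point /=; have e := imag_norm_sqr q.
case: q e => a b c d /= e; case: eqVneq => [n0|n0].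
  move: e; rewrite n0 expr0n /= => /esym e.
  move/eqP: e; rewrite !paddr_eq0 ?addr_ge0 ?sqr_ge0// !sqrf_eq0.
  move=> /andP[/andP[/eqP -> /eqP ->] /eqP ->].
  by apply: quat_eq => /=; ring.
by rewrite scalerA mulfV// scale1r; apply: quat_eq => /=; ring.
Qed.

Lemma slice_coord_point J z : imag_unit J ->
  slice_coord (slice_point J z) = (z.1, `|z.2|).
Proof.
move=> /(slice_pointE _ z)[b [c [d [_ e ->]]]].
rewrite /slice_coord /imag_norm /= !exprMn -!mulrDr e mulr1 sqrtr_sqr //.
Qed.

Lemma slice_point_inj J J' z : z.2 != 0 ->
  slice_point J z = slice_point J' z -> J = J'.
Proof. by move=> z0 /addrI/(scalerI z0). Qed.

(** A nonreal point has exactly two presentations, (z, J) and (conj z, -J), and the sign of [z.2]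
    tells which one is canonical. On the real axis the direction is lost. *)
Lemma slice_coordP J z : imag_unit J ->
  [\/ slice_coord (slice_point J z) = z /\ slice_dir (slice_point J z) = J,
      slice_coord (slice_point J z) = cconj z /\ slice_dir (slice_point J z) = - J
    | z.2 = 0 /\ slice_coord (slice_point J z) = z].
Proof.
move=> JJ; set x := slice_point J z.
have cx : slice_coord x = (z.1, `|z.2|) := slice_coord_point J z JJ.
have dx := slice_dirK x; have du := slice_dir_unit x.
have [z0|z0|z0] := ltgtP z.2 0.
- have cz : slice_coord x = cconj z by rewrite cx ltr0_norm.
  constructor 2; split => //; apply: (slice_point_inj _ _ (cconj z)) => //.
  + by rewrite /= oppr_eq0 lt_eqF.
  + transitivity x; first by rewrite -cz dx.
    by rewrite slice_pointN /x /slice_point /= opprK.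
- have cz : slice_coord x = z by rewrite cx gtr0_norm//; case: (z).
  constructor 1; split => //; apply: (slice_point_inj _ _ z) => //.
  + by rewrite gt_eqF.
  + by transitivity x; first by rewrite -{1}cz dx.
- by constructor 3; split => //; rewrite cx z0 normr0 -z0; case: (z).
Qed.

End ImaginaryUnits.

(** * The stem function of the quaternionic exponential *)

Section StemExponential.
Context {R : realType}.
Implicit Types (J u : quat R) (z w : R * R).

Lemma is_derive_cexp_line (f g : R -> R) (t df dg : R) :
    is_derive t (1 : R) f df -> is_derive t (1 : R) g dg ->
  is_derive t (1 : R) (fun t => (cexp (f t, g t)).1)
    (cmul (df, dg) (cexp (f t, g t))).1 /\
  is_derive t (1 : R) (fun t => (cexp (f t, g t)).2)
    (cmul (df, dg) (cexp (f t, g t))).2.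
Proof.
move=> hf hg.
have he : is_derive t (1 : R) (expR \o f) (df * expR (f t)).
  by rewrite mulrC; exact: (is_derive1_comp (is_derive_expR (f t)) hf).
have hc : is_derive t (1 : R) (cos \o g) (dg * - sin (g t)).
  by rewrite mulrC; exact: (is_derive1_comp (is_derive_cos (g t)) hg).
have hs : is_derive t (1 : R) (sin \o g) (dg * cos (g t)).
  by rewrite mulrC; exact: (is_derive1_comp (is_derive_sin (g t)) hg).
split; rewrite /cexp /cmul /=.
  by apply: (is_derive_eq (is_deriveM he hc)); rewrite /GRing.scale /=; ring.
by apply: (is_derive_eq (is_deriveM he hs)); rewrite /GRing.scale /=; ring.
Qed.

Lemma is_derive_affine (p q t : R) :
  is_derive t (1 : R) (fun t => t * p + q) p.
Proof.
rewrite (_ : (fun t => _) = (p *: id : R -> R) + cst q).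
  by apply: is_derive_eq; rewrite /GRing.scale /= mulr1 addr0.
by apply/funext => y; rewrite !fctE /GRing.scale /= mulrC.
Qed.

Lemma is_derive_cexp_fst w (a b : R) :
  is_derive a (1 : R) (fun t => (cexp (cmul (t, b) w)).1)
    (cmul w (cexp (cmul (a, b) w))).1 /\
  is_derive a (1 : R) (fun t => (cexp (cmul (t, b) w)).2)
    (cmul w (cexp (cmul (a, b) w))).2.
Proof.
have := is_derive_cexp_line _ _ a _ _ (is_derive_affine w.1 (- (b * w.2)) a)
  (is_derive_affine w.2 (b * w.1) a).
by case: w.
Qed.

(** The derivative in the second variable is i w exp(zw), whence the exchange of the two parts and
    the sign. *)
Lemma is_derive_cexp_snd w (a b : R) :
  is_derive b (1 : R) (fun t => (cexp (cmul (a, t) w)).1)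
    (- (cmul w (cexp (cmul (a, b) w))).2) /\
  is_derive b (1 : R) (fun t => (cexp (cmul (a, t) w)).2)
    (cmul w (cexp (cmul (a, b) w))).1.
Proof.
have := is_derive_cexp_line _ _ b _ _ (is_derive_affine (- w.2) (a * w.1) b)
  (is_derive_affine w.1 (a * w.2) b).
have e : (fun t => (t * - w.2 + a * w.1, t * w.1 + a * w.2)) =
    (fun t => cmul (a, t) w).
  by apply/funext => t; rewrite /cmul /=; congr pair; ring.
have -> : (fun t => (cexp (t * - w.2 + a * w.1, t * w.1 + a * w.2)).1) =
    (fun t => (cexp (cmul (a, t) w)).1).
  by apply/funext => t; rewrite -[cmul _ _]/((fun t => cmul (a, t) w) t) -e.
have -> : (fun t => (cexp (t * - w.2 + a * w.1, t * w.1 + a * w.2)).2) =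
    (fun t => (cexp (cmul (a, t) w)).2).
  by apply/funext => t; rewrite -[cmul _ _]/((fun t => cmul (a, t) w) t) -e.
have -> := congr1 (@^~ b) e.
case=> d1 d2; split.
  by apply: is_derive_eq d1 _; rewrite /cmul /=; ring.
by apply: is_derive_eq d2 _; rewrite /cmul /=; ring.
Qed.

Lemma is_derive_cexp w z :
  [/\ is_derive z (1, 0) (fun z => (cexp (cmul z w)).1) (cmul w (cexp (cmul z w))).1,
      is_derive z (1, 0) (fun z => (cexp (cmul z w)).2) (cmul w (cexp (cmul z w))).2,
      is_derive z (0, 1) (fun z => (cexp (cmul z w)).1) (- (cmul w (cexp (cmul z w))).2)
    & is_derive z (0, 1) (fun z => (cexp (cmul z w)).2) (cmul w (cexp (cmul z w))).1].
Proof.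
case: z => a b.
have [[d1 e1] [d2 e2]] := is_derive_cexp_fst w a b.
have [[d3 e3] [d4 e4]] := is_derive_cexp_snd w a b.
pose f1 (z : R * R) : R := (cexp (cmul z w)).1.
pose f2 (z : R * R) : R := (cexp (cmul z w)).2.
have [p1 q1] := derivable_partial1 f1 a b.
have [p2 q2] := derivable_partial1 f2 a b.
have [p3 q3] := derivable_partial2 f1 a b.
have [p4 q4] := derivable_partial2 f2 a b.
split; apply: DeriveDef.
- exact: (proj2 p1 d1).
- exact: (etrans q1 e1).
- exact: (proj2 p2 d2).
- exact: (etrans q2 e2).
- exact: (proj2 p3 d3).
- exact: (etrans q3 e3).
- exact: (proj2 p4 d4).
- exact: (etrans q4 e4).
Qed.

Lemma continuous_cexp w :
  continuous (fun z => (cexp (cmul z w)).1) /\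
  continuous (fun z => (cexp (cmul z w)).2).
Proof.
have c1 : continuous (fun z : R * R => (cmul z w).1).
  move=> z; apply: cvgB; apply: cvgM; try exact: cvg_cst.
    exact: cvg_fst.
  exact: cvg_snd.
have c2 : continuous (fun z : R * R => (cmul z w).2).
  move=> z; apply: cvgD; apply: cvgM; try exact: cvg_cst.
    exact: cvg_fst.
  exact: cvg_snd.
split=> z; apply: cvgM.
- by apply: continuous_cvg; [exact: continuous_expR|exact: c1].
- by apply: continuous_cvg; [exact: continuous_cos|exact: c2].
- by apply: continuous_cvg; [exact: continuous_expR|exact: c1].
- by apply: continuous_cvg; [exact: continuous_sin|exact: c2].
Qed.

(** The element x + iota y of R[iota, u], with [x] and [y] read in C_u. *)
Definition bicomplex u (x y : R * R) : cquat R :=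
  CQuat (slice_point u x) (slice_point u y).

Lemma bicomplex0 u w : CQuat (slice_point u w) 0 = bicomplex u w 0.
Proof. by rewrite /bicomplex /slice_point !scale0r addr0. Qed.

Lemma bicomplexE u (a b c d : R) :
  bicomplex u (a, b) (c, d) =
  a *: (1 : cquat R) + b *: CQuat u 0 + (c *: CQuat 0 1 + d *: CQuat 0 u).
Proof.
apply: cquat_eq; rewrite /= ?scaler0 ?addr0 ?add0r //.
Qed.

Lemma bicomplexM u (x y x' y' : R * R) : imag_unit u ->
  bicomplex u x y * bicomplex u x' y' =
  bicomplex u (cmul x x' - cmul y y') (cmul x y' + cmul y x').
Proof.
move=> uu; apply: cquat_eq; rewrite /= slice_pointD ?slice_point_opp !slice_pointM //.
Qed.

Lemma bicomplexC u (x y x' y' : R * R) : imag_unit u ->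
  bicomplex u x y * bicomplex u x' y' = bicomplex u x' y' * bicomplex u x y.
Proof.
move=> uu; rewrite !bicomplexM//; congr bicomplex;
  rewrite /cmul; congr pair => /=; ring.
Qed.

(* The idempotents (1 -+ iota u)/2 split the commutative algebra generated by
   iota and u into two copies of C, on which multiplication by a + s u becomes
   multiplication by a + s i and a - s i. *)
Definition stem_exp u w z : cquat R :=
  let P := cexp (cmul z w) in let Q := cexp (cmul z (cconj w)) in
  bicomplex u ((P.1 + Q.1) / 2, (P.2 - Q.2) / 2)
              ((P.2 + Q.2) / 2, (Q.1 - P.1) / 2).

Lemma is_derive_bicomplex u (fa fb fc fd : R * R -> R) (da db dc dd : R) z v :
    is_derive z v fa da -> is_derive z v fb db -> is_derive z v fc dc ->
    is_derive z v fd dd ->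
  is_derive z v (fun z => bicomplex u (fa z, fb z) (fc z, fd z))
    (bicomplex u (da, db) (dc, dd)).
Proof.
move=> ha hb hc hd; rewrite bicomplexE.
rewrite (_ : (fun z => _) = (fun z => fa z *: (1 : cquat R)) +
  (fun z => fb z *: CQuat u 0) +
  ((fun z => fc z *: CQuat 0 1) + (fun z => fd z *: CQuat 0 u))); last first.
  by apply/funext => t; rewrite bicomplexE !fctE.
have ha' := is_derive_scalel fa (1 : cquat R) z v da ha.
have hb' := is_derive_scalel fb (CQuat u 0) z v db hb.
have hc' := is_derive_scalel fc (CQuat 0 1) z v dc hc.
have hd' := is_derive_scalel fd (CQuat 0 u) z v dd hd.
have h1 := is_deriveD ha' hb'.
have h2 := is_deriveD hc' hd'.
exact: (is_deriveD h1 h2).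
Qed.

(** The computation is done in the four real coordinates over 1, u, iota, iota u. The second
    derivative is iota times the first, which is holomorphy. *)
Lemma is_derive_stem_exp {u} w z : imag_unit u ->
  is_derive z (1, 0) (stem_exp u w) (stem_exp u w z * CQuat (slice_point u w) 0) /\
  is_derive z (0, 1) (stem_exp u w)
    (cqi * (stem_exp u w z * CQuat (slice_point u w) 0)).
Proof.
move=> uu; have [h1 h2 h3 h4] := is_derive_cexp w z.
have [k1 k2 k3 k4] := is_derive_cexp (cconj w) z.
have iE : cqi = bicomplex u 0 (1, 0).
  by rewrite /bicomplex /slice_point /= !scale0r !addr0 scale1r.
rewrite bicomplex0 iE.
have hf (f g : R * R -> R) v df dg : is_derive z v f df -> is_derive z v g dg ->
    is_derive z v (fun z => (f z + g z) / 2) ((df + dg) / 2).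
  move=> hf hg; rewrite (_ : (fun z => _) = 2^-1 *: (f + g)).
    by apply: is_derive_eq; rewrite mulrC.
  by apply/funext => t; rewrite fctE /GRing.scale /= mulrC.
have hb (f g : R * R -> R) v df dg : is_derive z v f df -> is_derive z v g dg ->
    is_derive z v (fun z => (f z - g z) / 2) ((df - dg) / 2).
  move=> hf' hg; rewrite (_ : (fun z => _) = 2^-1 *: (f - g)).
    by apply: is_derive_eq; rewrite mulrC.
  by apply/funext => t; rewrite fctE /GRing.scale /= mulrC.
split.
- apply: (is_derive_eq (is_derive_bicomplex u _ _ _ _ _ _ _ _ z _
    (hf _ _ _ _ _ h1 k1) (hb _ _ _ _ _ h2 k2)
    (hf _ _ _ _ _ h2 k2) (hb _ _ _ _ _ k1 h1))).
  by rewrite bicomplexM//; congr bicomplex; rewrite /cmul /=; congr pair => /=; field.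
- apply: (is_derive_eq (is_derive_bicomplex u _ _ _ _ _ _ _ _ z _
    (hf _ _ _ _ _ h3 k3) (hb _ _ _ _ _ h4 k4)
    (hf _ _ _ _ _ h4 k4) (hb _ _ _ _ _ k3 h3))).
  by rewrite !bicomplexM//; congr bicomplex; rewrite /cmul /=; congr pair => /=; field.
Qed.

Lemma continuous_bicomplex u (fa fb fc fd : R * R -> R) :
    continuous fa -> continuous fb -> continuous fc -> continuous fd ->
  continuous (fun z => bicomplex u (fa z, fb z) (fc z, fd z)).
Proof.
move=> ha hb hc hd z; rewrite /continuous_at bicomplexE.
rewrite (_ : (fun z => _) = (fun z => fa z *: (1 : cquat R) + fb z *: CQuat u 0 +
  (fc z *: CQuat 0 1 + fd z *: CQuat 0 u))); last first.
  by apply/funext => t; rewrite bicomplexE.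
apply: cvgD; apply: cvgD; apply: cvgZr_tmp; by [exact: ha|exact: hb|exact: hc|exact: hd].
Qed.

Lemma continuous_stem_exp u w : continuous (stem_exp u w).
Proof.
have [p1 p2] := continuous_cexp w; have [q1 q2] := continuous_cexp (cconj w).
apply: continuous_bicomplex => z; (apply: cvgM; last exact: cvg_cst).
- by apply: cvgD; [exact: p1|exact: q1].
- by apply: cvgB; [exact: p2|exact: q2].
- by apply: cvgD; [exact: p2|exact: q2].
- by apply: cvgB; [exact: q1|exact: p1].
Qed.

Lemma partial_stem_exp {u} w z : imag_unit u ->
  partial_alpha (stem_exp u w) z = stem_exp u w z * CQuat (slice_point u w) 0 /\
  partial_beta (stem_exp u w) z = cqi * (stem_exp u w z * CQuat (slice_point u w) 0).
Proof.
by move=> uu; have [h1 h2] := is_derive_stem_exp w z uu; split; exact: derive_val.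
Qed.

Lemma class_C1_stem_exp D u w : imag_unit u -> class_C1 D (stem_exp u w).
Proof.
move=> uu z _; have [h1 h2] := is_derive_stem_exp w z uu; split.
- exact: ex_derive.
- exact: ex_derive.
- rewrite (_ : partial_alpha _ = fun z => stem_exp u w z * CQuat (slice_point u w) 0).
    by apply: cvg_cquatM; [exact: continuous_stem_exp|exact: cvg_cst].
  by apply/funext => y; have [-> _] := partial_stem_exp w y uu.
- rewrite (_ : partial_beta _ =
      fun z => cqi * (stem_exp u w z * CQuat (slice_point u w) 0)).
    apply: cvg_cquatM; first exact: cvg_cst.
    by apply: cvg_cquatM; [exact: continuous_stem_exp|exact: cvg_cst].
  by apply/funext => y; have [_ ->] := partial_stem_exp w y uu.
Qed.

Lemma dz_stem_exp u w z : imag_unit u ->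
  dz (stem_exp u w) z = stem_exp u w z * CQuat (slice_point u w) 0.
Proof.
move=> uu; rewrite /dz; have [-> ->] := partial_stem_exp w z uu.
rewrite mulrA cqi_sqr mulN1r opprK scalerDr -scalerDl.
by rewrite (_ : 2^-1 + 2^-1 = 1 :> R) ?scale1r//; lra.
Qed.

Lemma dzbar_stem_exp u w z : imag_unit u -> dzbar (stem_exp u w) z = 0.
Proof.
move=> uu; rewrite /dzbar; have [-> ->] := partial_stem_exp w z uu.
by rewrite mulrA cqi_sqr mulN1r subrr scaler0.
Qed.

Lemma cexp_conj z : cexp (cconj z) = cconj (cexp z).
Proof. by rewrite /cexp /cconj /= cosN sinN mulrN. Qed.

Lemma cexpN z : cmul (cexp z) (cexp (- z)) = (1, 0).
Proof.
rewrite /cmul /cexp /= cosN sinN; have e := expRxMexpNx_1 z.1.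
have cs := cos2Dsin2 z.2; congr pair; last by ring.
transitivity ((expR z.1 * expR (- z.1)) * (cos z.2 ^+ 2 + sin z.2 ^+ 2)).
  by ring.
by rewrite e cs mulr1.
Qed.

(** Conjugating [z] replaces the pair (P, Q) of complex exponentials by (conj Q, conj P): the first
    two coordinates are kept and the last two change sign. *)
Lemma stem_exp_stem D u w : stem_function D (stem_exp u w).
Proof.
move=> z _; rewrite /stem_exp.
have e1 : cmul (cconj z) w = cconj (cmul z (cconj w)).
  by rewrite /cmul /cconj /=; congr pair; ring.
have e2 : cmul (cconj z) (cconj w) = cconj (cmul z w).
  by rewrite /cmul /cconj /=; congr pair; ring.
rewrite e1 e2 !cexp_conj; move: (cexp _) (cexp _) => P Q.
rewrite /cqconj /bicomplex /= -slice_point_opp.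
by congr CQuat; congr slice_point; congr pair => /=; ring.
Qed.

Lemma stem_expV u w z : imag_unit u ->
  stem_exp u w z * stem_exp u (- w) z = 1 /\
  stem_exp u (- w) z * stem_exp u w z = 1.
Proof.
move=> uu; suff e : stem_exp u w z * stem_exp u (- w) z = 1.
  by split => //; rewrite -e /stem_exp bicomplexC.
rewrite /stem_exp bicomplexM//.
have e1 : cmul z (- w) = - cmul z w by rewrite /cmul; congr pair => /=; ring.
have e2 : cmul z (cconj (- w)) = - cmul z (cconj w).
  by rewrite /cmul; congr pair => /=; ring.
rewrite e1 e2; have := cexpN (cmul z w); have := cexpN (cmul z (cconj w)).
move: (cexp (cmul z w)) (cexp (- cmul z w)) => [p1 p2] [p1' p2'].
move: (cexp (cmul z (cconj w))) (cexp (- cmul z (cconj w))) => [q1 q2] [q1' q2'].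
rewrite /cmul /= => -[h1 h2] [h3 h4].
rewrite (_ : 1 = bicomplex u (1, 0) 0); last first.
  by apply: cquat_eq; rewrite /slice_point /= ?scale1r !scale0r addr0.
(* Products of a P by a Q cancel; the coordinates are linear in the parts of PP' = 1 and QQ' = 1. *)
by congr bicomplex; congr pair => /=; lra.
Qed.

Lemma stem_exp_comm u w w' z : imag_unit u ->
  stem_exp u w z * CQuat (slice_point u w') 0 =
  CQuat (slice_point u w') 0 * stem_exp u w z.
Proof.
by move=> uu; rewrite bicomplex0 [LHS]bicomplexC.
Qed.

(** [J] and [u] need not commute, but x^n stands to the left of l^n, so each term of the series is a
    combination of 1, u, J and Ju. Its coefficients are half-sums and half-differences of the parts
    of (zw)^n / n! and (z conj w)^n / n!, whose series are known. *)
Lemma induces_qexp D u w : imag_unit u ->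
  induces D (stem_exp u w) (qexp (slice_point u w)).
Proof.
move=> uu; split; first exact: stem_exp_stem.
move=> z J _ JJ; apply/cvg_lim; first exact: norm_hausdorff.
have [P1 P2] := cvg_cexp (cmul z w); have [Q1 Q2] := cvg_cexp (cmul z (cconj w)).
set a1 := fun n => (cpow (cmul z w) n).1 / n`!%:R in P1.
set a2 := fun n => (cpow (cmul z w) n).2 / n`!%:R in P2.
set b1 := fun n => (cpow (cmul z (cconj w)) n).1 / n`!%:R in Q1.
set b2 := fun n => (cpow (cmul z (cconj w)) n).2 / n`!%:R in Q2.
have termE n : (n`!%:R : R)^-1 *: (slice_point J z ^+ n * slice_point u w ^+ n) =
    ((a1 n + b1 n) / 2)%:A + ((a2 n - b2 n) / 2) *: u +
    (((a2 n + b2 n) / 2) *: J + ((b1 n - a1 n) / 2) *: (J * u)).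
  rewrite /a1 /a2 /b1 /b2 !cpow_mul cpow_conj -!slice_pointX//.
  move: (cpow z n) (cpow w n) => [p q] [r t].
  have n0 : (n`!%:R : R) != 0 by rewrite pnatr_eq0 -lt0n fact_gt0.
  rewrite /slice_point /cmul /= mulrDl !mulrDr -!scalerAl -!scalerAr !mulr1 !mul1r.
  by rewrite !scalerDr !scalerA; congr (_ *: _ + _ *: _ + (_ *: _ + _ *: _)); field.
rewrite (_ : series _ = (fun N => ((series a1 N + series b1 N) / 2)%:A +
    ((series a2 N - series b2 N) / 2) *: u +
    (((series a2 N + series b2 N) / 2) *: J +
     ((series b1 N - series a1 N) / 2) *: (J * u)))); last first.
  apply/funext => N; rewrite /series /=; under eq_bigr do rewrite termE.
  by rewrite !big_split /= -!scaler_suml !big_split /= !sumrN.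
rewrite /stem_exp /= /slice_point /= mulrDr -!scalerAr mulr1.
apply: cvgD; apply: cvgD; apply: cvgZr_tmp.
- by apply: cvgM; [exact: cvgD|exact: cvg_cst].
- by apply: cvgM; [exact: cvgB|exact: cvg_cst].
- by apply: cvgM; [exact: cvgD|exact: cvg_cst].
- by apply: cvgM; [exact: cvgB|exact: cvg_cst].
Qed.

End StemExponential.

(** * Slice functions *)

Section SliceFunctionTheory.
Context {R : realType}.
Implicit Types (D : set (R * R)) (F G : R * R -> cquat R) (f g : quat R -> quat R).
Implicit Types (z : R * R) (x : quat R).

Definition conj_invariant D := forall z, D z -> D (cconj z).

Lemma cconjK z : cconj (cconj z) = z.
Proof. by case: z => a b; rewrite /cconj /= opprK. Qed.

Lemma imag_unit_i : imag_unit (Quat 0 1 0 0 : quat R).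
Proof. by apply: quat_eq => /=; ring. Qed.

Lemma half_double (q : quat R) : 2^-1 *: (q + q) = q.
Proof.
by rewrite scalerDr -scalerDl (_ : 2^-1 + 2^-1 = 1 :> R) ?scale1r//; lra.
Qed.

Lemma oppq_eq_id (q : quat R) : - q = q -> q = 0.
Proof. by move=> e; rewrite -[LHS]half_double -{1}e addNr scaler0. Qed.

(** The values at [J] and [-J] determine both components: their sum gives the first, and then either
    value gives the second. *)
Lemma induces_unique {D F G f} : induces D F f -> induces D G f ->
  forall z, D z -> F z = G z.
Proof.
move=> [_ hF] [_ hG] z Dz; set J : quat R := Quat 0 1 0 0.
have JJ : imag_unit J := imag_unit_i.
have JN := imag_unitN JJ.
have := etrans (esym (hF z J Dz JJ)) (hG z J Dz JJ).
have := etrans (esym (hF z _ Dz JN)) (hG z _ Dz JN).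
case: (F z) (G z) => p q [p' q'] /= e2 e1.
have ep : p = p'.
  rewrite -[p]half_double -[p']half_double; congr (_ *: _).
  have := congr2 +%R e1 e2.
  by rewrite !mulNr addrACA subrr addr0 addrACA subrr addr0.
subst p'; congr CQuat; move/addrI: e1 => /(congr1 ( *%R J)).
by rewrite !mulrA JJ !mulN1r => /oppr_inj.
Qed.

Lemma induces_ext {D F G f} : conj_invariant D -> (forall z, D z -> F z = G z) ->
  induces D F f -> induces D G f.
Proof.
move=> cD FG [sF hF]; split=> [z Dz|z J Dz JJ].
  by rewrite -!FG//; [exact: sF|exact: cD].
by rewrite hF// FG.
Qed.

Lemma induces_cst D (c : quat R) : induces D (cst (CQuat c 0)) (cst c).
Proof.
split=> [z _|z J _ _]; first by rewrite /cqconj /= oppr0.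
by rewrite /= mulr0 addr0.
Qed.

(** [J] multiplies the second component from the left, so a constant factor on the right passes
    through. *)
Lemma induces_mulr {D F f} (c : quat R) :
  induces D F f -> induces D (fun z => F z * CQuat c 0) (fun x => f x * c).
Proof.
move=> [sF hF]; split=> [z Dz|z J Dz JJ].
  rewrite sF//; apply: cquat_eq; rewrite /= ?mulr0 ?mulNr ?oppr0 ?add0r //.
by rewrite hF//= !mulr0 subr0 add0r mulrDl mulrA.
Qed.

Lemma stem_functionM {D F G} :
  stem_function D F -> stem_function D G -> stem_function D (F \* G).
Proof.
move=> sF sG z Dz; rewrite /= sF// sG//.
apply: cquat_eq; rewrite /= ?mulrNN // mulrN mulNr opprD //.
Qed.

Definition slice_extension F x : quat R :=
  cqre (F (slice_coord x)) + slice_dir x * cqim (F (slice_coord x)).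

(** The stem symmetry makes the value independent of the presentation of the point. *)
Lemma induces_slice_extension D F :
  stem_function D F -> induces D F (slice_extension F).
Proof.
move=> sF; split => // z J Dz JJ; rewrite /slice_extension.
have [[-> ->]//|[-> ->]|[z0 ->]] := slice_coordP J z JJ.
  by rewrite sF//= mulrNN.
(* At a real point the second component equals its opposite and vanishes, so the arbitrary choice of
   direction is harmless. *)
have : cqconj (F z) = F z.
  by rewrite -sF//; congr F; case: z z0 {Dz} => a b /= ->; rewrite /cconj /= oppr0.
move=> /(congr1 (@cqim R)) /= e.
by rewrite (oppq_eq_id _ e) !mulr0.
Qed.

Lemma circularizationE D x :
  conj_invariant D -> circularization D x <-> D (slice_coord x).
Proof.
move=> cD; split.
  move=> [z [J [Dz JJ ->]]].
  by have [[-> _]|[-> _]|[_ ->]] := slice_coordP J z JJ => //; exact: cD.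
move=> Dx; exists (slice_coord x), (slice_dir x); split => //.
  exact: slice_dir_unit.
by rewrite slice_dirK.
Qed.

Lemma cst_class_C1 D (c : cquat R) : class_C1 D (cst c).
Proof.
move=> z _.
have ea : partial_alpha (cst c) = cst 0.
  by apply/funext => y; exact: derive_cst.
have eb : partial_beta (cst c) = cst 0.
  by apply/funext => y; exact: derive_cst.
split; try exact: derivable_cst.
- by rewrite ea; exact: cvg_cst.
- by rewrite eb; exact: cvg_cst.
Qed.

Lemma dz_cst (c : cquat R) z : dz (cst c) z = 0 /\ dzbar (cst c) z = 0.
Proof.
rewrite /dz /dzbar /partial_alpha /partial_beta !derive_cst mulr0 subr0 addr0.
by rewrite scaler0.
Qed.

(** The stem function hidden in [slice_dx] agrees with [F] on [D]; as [D] is open, the derivatives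
    agree too. *)
Lemma slice_dx0P {D F g} : axially_symmetric_domain D -> induces D F g ->
  slice_dx D g (cst 0) -> forall z, D z -> dz F z = 0.
Proof.
move=> [oD _ _ _] iF [G [C1G iG idG]] z Dz.
have [ea eb] := partial_near_eq oD (induces_unique iF iG) Dz.
rewrite /dz ea eb; exact: (induces_unique idG (induces_cst D 0) z Dz).
Qed.

Lemma slice_dxc0P {D F g} : axially_symmetric_domain D -> induces D F g ->
  slice_dxc D g (cst 0) -> forall z, D z -> dzbar F z = 0.
Proof.
move=> [oD _ _ _] iF [G [C1G iG idG]] z Dz.
have [ea eb] := partial_near_eq oD (induces_unique iF iG) Dz.
rewrite /dzbar ea eb; exact: (induces_unique idG (induces_cst D 0) z Dz).
Qed.

(** Both coordinates are 1-Lipschitz; the second is the norm of the imaginary part. *)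
Lemma slice_coord_continuous : continuous (@slice_coord R).
Proof.
move=> p; have FF : Filter (nbhs p) by exact: nbhs_filter.
apply/cvgrPdist_lt => e e0.
apply: filterS (nbhsx_ballx p e e0) => q; rewrite -ball_normE /= => pq.
pose im (r : quat R) : quat R := Quat 0 (qim1 r) (qim2 r) (qim3 r).
have imE r : imag_norm r = `|im r|.
  by rewrite -[RHS]/(qnorm _) /qnorm /= expr0n add0r.
have im_le r : `|im r| <= `|r|.
  rewrite -imE -[leRHS]/(qnorm _) /qnorm ler_wsqrtr// -!addrA lerDr.
  exact: sqr_ge0.
rewrite prod_normE gt_max /=; apply/andP; split.
  by apply: le_lt_trans pq; case: (quat_coord_le (p - q)).
rewrite !imE; apply: le_lt_trans pq; apply: le_trans (ler_dist_dist _ _) _.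
rewrite (_ : im p - im q = im (p - q)) ?im_le//.
by apply: quat_eq => //=; rewrite subr0.
Qed.

Lemma open_circularization D : open D -> conj_invariant D ->
  open (circularization D).
Proof.
move=> oD cD; rewrite (_ : circularization D = @slice_coord R @^-1` D).
  by apply: open_comp => // x _; exact: slice_coord_continuous.
by apply/seteqP; split => x /circularizationE; exact.
Qed.

(** The connected set at hand is the circularization, not [D], so the clopen argument takes place in
    H. *)
Lemma slice_domain_locally_cst D F g : slice_domain D -> induces D F g ->
    (forall z, D z -> \forall w \near z, F w = F z) ->
  exists c : quat R, forall x, circularization D x -> g x = c.
Proof.
move=> [[oD cD oO cO] [a aO]] [sF gF] lF.
have Da : D (slice_coord a%:A) by apply/circularizationE.
set z0 := slice_coord _ in Da.
have z02 : z0.2 = 0.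
  by rewrite /z0 /slice_coord /imag_norm /= !mulr0 expr0n !addr0 sqrtr0.
have Fz0 : F z0 = CQuat (cqre (F z0)) 0.
  have := sF z0 Da; have -> : cconj z0 = z0.
    by move: z02; case: (z0) => b d /= ->; rewrite /cconj /= oppr0.
  case: (F z0) => p q [] /= e; congr CQuat.
  exact: oppq_eq_id.
set c := cqre (F z0) in Fz0; exists c.
pose D1 : set (R * R) := [set z | D z /\ F z = CQuat c 0].
pose D2 : set (R * R) := [set z | D z /\ F z <> CQuat c 0].
(* The value [CQuat c 0] is fixed by conjugation, so [D1] and [D2] are both symmetric and have open
   circularizations. *)
have cD1 : conj_invariant D1.
  by move=> z [Dz Fz]; split; [exact: cD|rewrite sF// Fz /cqconj /= oppr0].
have cD2 : conj_invariant D2.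
  move=> z [Dz Fz]; split=> [|h]; first exact: cD.
  apply: Fz; rewrite -(cconjK z) sF ?h; last exact: cD.
  by rewrite /cqconj /= oppr0.
have oD1 : open D1.
  rewrite openE => z [Dz Fz]; apply: filterS2 (open_near oD Dz) (lF z Dz) => w Dw Fw.
  by split => //; rewrite Fw.
have oD2 : open D2.
  rewrite openE => z [Dz Fz]; apply: filterS2 (open_near oD Dz) (lF z Dz) => w Dw Fw.
  by split => //; rewrite Fw.
have sub1 : circularization D1 `<=` circularization D.
  by move=> x [z [J [[Dz _] JJ ->]]]; exists z, J.
have O1 : circularization D1 = circularization D.
  apply: cO.
  - by exists a%:A; apply/circularizationE.
  - exists (circularization D1); first exact: open_circularization.
    by apply/seteqP; split => [x Ux|x []//]; split => //; exact: sub1.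
  (* Relative closedness: within the circularization of [D], that of [D1] is the complement of that
     of [D2]. *)
  - exists (~` circularization D2); first exact/open_closedC/open_circularization.
    apply/seteqP; split => x.
      move=> Ux; split; first exact: sub1.
      move=> /(circularizationE _ _ cD2)[_ n2].
      by move/(circularizationE _ _ cD1): Ux => [].
    move=> [/(circularizationE _ _ cD) Dx n2]; apply/(circularizationE _ _ cD1).
    split => //; apply: contrapT => nF; apply: n2.
    exact/(circularizationE _ _ cD2).
move=> x; rewrite -O1 => -[z [J [[Dz Fz] JJ ->]]].
by rewrite gF// Fz /= mulr0 addr0.
Qed.

End SliceFunctionTheory.

(** * Solutions of the eigenvalue equation df/dx = f l *)

Theorem proposition3 (R : realType) (D : set (R * R)) (l : quat R)
    (hD : axially_symmetric_domain D) :
  (forall f : quat R -> quat R, slice_C1 D f ->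
     (slice_dx D f (fun x => f x * l) <->
      exists g : quat R -> quat R,
        anti_slice_regular D g /\ slice_product D g (qexp l) f)) /\
  (forall f g : quat R -> quat R, slice_C1 D f ->
     anti_slice_regular D g -> slice_product D g (qexp l) f ->
     (slice_regular D f <-> anti_slice_regular D g /\ slice_regular D g)) /\
  (forall g : quat R -> quat R,
     anti_slice_regular D g /\ slice_regular D g <-> slice_constant D g) /\
  (slice_domain D -> forall g : quat R -> quat R,
     slice_constant D g <->
     exists c : quat R, forall x, circularization D x -> g x = c).
Proof.
have [oD cD _ _] := hD.
pose u := slice_dir l; pose w := slice_coord l.
have uu : imag_unit u := slice_dir_unit l.
have lE : slice_point u w = l := slice_dirK l.
pose E := stem_exp u w; pose E' := stem_exp u (- w).
have C1E : class_C1 D E := class_C1_stem_exp D _ w uu.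
have C1E' : class_C1 D E' := class_C1_stem_exp D _ (- w) uu.
have iE : induces D E (qexp l) by rewrite -lE; exact: induces_qexp.
have sE' : stem_function D E' := stem_exp_stem D u (- w).
(* By uniqueness, the stem functions hidden in the slice product may be taken to be [G] and [E]. *)
have prodE (G : R * R -> cquat R) (g f : quat R -> quat R) : induces D G g ->
    slice_product D g (qexp l) f -> induces D (G \* E) f.
  move=> iG [G1 [E1 [iG1 iE1 iGE]]]; apply: induces_ext cD _ iGE => z Dz /=.
  by rewrite (induces_unique iG1 iG z Dz) (induces_unique iE1 iE z Dz).
split; [|split; [|split]].
- move=> f _; split.
    move=> [F [C1F iF idF]]; pose G := F \* E'.
    have C1G : class_C1 D G := class_C1M oD C1F C1E'.
    have iG : induces D G (slice_extension G).
      by apply: induces_slice_extension; apply: stem_functionM => //; case: iF.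
    exists (slice_extension G); split.
      exists G; split => //; apply: induces_ext cD _ (induces_cst D 0) => z Dz.
      (* The factor -l is moved to the left of [E'], next to [F], where it cancels the term F l
         coming from the equation. *)
      have dE' : dz E' z = CQuat (- l) 0 * E' z.
        by rewrite /E' dz_stem_exp// stem_exp_comm// slice_point_opp lE.
      rewrite (dzM C1F C1E' Dz) dE'.
      rewrite (induces_unique idF (induces_mulr l iF) z Dz).
      rewrite -mulrA -mulrDr -mulrDl.
      rewrite (_ : _ + _ = 0) ?mul0r ?mulr0//.
      by apply: cquat_eq; rewrite /= ?subrr ?addr0.
    exists G, E; split => //; apply: induces_ext cD _ iF => z Dz /=.
    by rewrite /G /= -mulrA; have [_ ->] := stem_expV u w z uu; rewrite mulr1.
  (* Conversely, dG/dz = 0 leaves d(GE)/dz = G dE/dz = G E l. *)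
  move=> [g [ag pg]]; have [G [C1G iG idG]] := ag.
  have iF := prodE _ _ _ iG pg; exists (G \* E); split => //.
    exact: class_C1M.
  apply: induces_ext cD _ (induces_mulr l iF) => z Dz.
  rewrite (dzM C1G C1E Dz) (slice_dx0P hD iG ag z Dz) mul0r add0r.
  by rewrite dz_stem_exp// lE mulrA.
- move=> f g _ ag pg; have [G [C1G iG _]] := ag; have iGE := prodE _ _ _ iG pg.
  split.
    move=> rf; split => //; have [F [C1F iF _]] := rf.
    (* Here G = F E' on [D], a product of two holomorphic factors. *)
    exists (F \* E'); split; first exact: class_C1M.
      apply: induces_ext cD _ iG => z Dz; rewrite /= (induces_unique iF iGE z Dz) /=.
      by rewrite -mulrA; have [-> _] := stem_expV u w z uu; rewrite mulr1.
    apply: induces_ext cD _ (induces_cst D 0) => z Dz.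
    rewrite (dzbarM C1F C1E' Dz) dzbar_stem_exp// (slice_dxc0P hD iF rf z Dz).
    by rewrite mul0r mulr0 addr0.
  move=> [_ rg]; exists (G \* E); split => //; first exact: class_C1M.
  apply: induces_ext cD _ (induces_cst D 0) => z Dz.
  rewrite (dzbarM C1G C1E Dz) dzbar_stem_exp// (slice_dxc0P hD iG rg z Dz).
  by rewrite mul0r mulr0 addr0.
- by move=> g; split=> -[].
- move=> sD g; split.
    move=> [rg ag]; have [G [C1G iG _]] := ag.
    apply: (slice_domain_locally_cst _ _ _ sD iG).
    apply: (partials0_locally_cst oD C1G) => z Dz.
    by apply: partials0P; [exact: slice_dx0P ag z Dz|exact: slice_dxc0P rg z Dz].
  move=> [c gc].
  (* Only the values of [g] on the circularization matter, so the constant stem function induces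
     it. *)
  have ig : induces D (cst (CQuat c 0)) g.
    have [sc cc] := induces_cst D c; split => // z J Dz JJ.
    by rewrite -cc// gc//; exists z, J.
  have C1c := cst_class_C1 D (CQuat c 0).
  split; exists (cst (CQuat c 0)); split => //;
    apply: induces_ext cD _ (induces_cst D 0) => z Dz;
    by have [e1 e2] := dz_cst (CQuat c 0) z.
Qed.
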